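(* Let $f$ be a parabolic germ at $0$, let $\mathcal P$ be an attracting petal of $f$, let $F(w)=w+1+\eta\big(1/\sqrt[n]{w}\big)$ be the conjugate of $f^q$ in the coordinate $w=d/z^n$ on $\mathcal P$, and let $r>0$ be small enough that $|\eta(\xi)|\le\frac12$ for all $|\xi|\le r$ (all as specified in the context). Suppose $\tau>1/r^n+1$ is a real number and let $R_\tau=\{w\in\mathbb C:\Re w>\tau\}$. Then there is a simply connected domain $\Omega$ and a conformal map $\Psi$ from $R_\tau$ onto $\Omega$ such that $$F(\Psi(w))=\Psi(w+1)\qquad\text{for all } w\in R_\tau.$$
   Context: A parabolic germ at $0$ is a map $f$ which, after a change of coordinates, is defined and conformal in a disk $\{|z|<r_0\}$, $0<r_0<1/2$, with Taylor expansion $f(z)=e^{2\pi i p/q}z+\text{(higher order terms)}$, $(p,q)=1$; it is assumed that $f^m\not\equiv \mathrm{id}$ for all $m>0$ (powers denote iterates). Then $f^q(z)=z(1+az^n+\epsilon(z))$ for $|z|<r_0$, with $a\ne0$, $n$ a multiple of $q$, and $\epsilon(z)=a_{n+1}z^{n+1}+a_{n+2}z^{n+2}+\cdots$ a convergent power series. For $0<r<r_0$ and $\Delta_r=\{|z|<r\}$, an attracting petal of $f$ is a simply connected open set $\mathcal P\subset\Delta_r\cap f^q(\Delta_r)$ with $f^q(\mathcal P)\subset\mathcal P$ and $0\in\overline{\mathcal P}$ such that $(f^q)^m(z)$ converges uniformly to $0$ for $z\in\mathcal P$ as $m\to\infty$. On an attracting petal $\mathcal P$ use the coordinate $w=\phi(z)=d/z^n$,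 $d=-\frac1{na}$, and suppose that the image of $\mathcal P$ under $\phi$ is a right half-plane $R_\tau=\{w\in\mathbb C:\Re w>\tau\}$, so that $\phi^{-1}(w)=\sqrt[n]{d/w}:R_\tau\to\mathcal P$ is conformal. The conjugate of $f^q$ by $\phi$ is $$F(w)=\phi\circ f^q\circ\phi^{-1}(w)=w+1+\eta\Big(\frac1{\sqrt[n]{w}}\Big),\qquad w\in R_\tau,$$ where $\eta(\xi)=b_1\xi+b_2\xi^2+\cdots$ is an analytic function in a neighborhood of $0$ given by a convergent power series for $|\xi|\le r$, and $r$ is taken small enough that $|\eta(\xi)|\le\frac12$ for all $|\xi|\le r$. (Then $F(R_\tau)\subset R_\tau$ whenever $\tau\ge 1/r^n$.)
   Formalization: F is evaluated by its formula (principal n-th root) on the slit plane where |1/w^{1/n}| ≤ r, and Ω is only required to lie there: with F confined to the half-plane R_τ the claim fails, e.g. for n = 2, b_1 = -1. *)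

(* Defs.v *)
From Stdlib Require Import Reals ZArith.
From Coquelicot Require Import Coquelicot.
Open Scope R_scope.

(** * Complex analysis and topology of the plane *)

Definition disk (r : R) (z : C) : Prop := Cmod z < r.

Definition right_half_plane (tau : R) (w : C) : Prop := tau < Re w.

(** Complex differentiability: the scalars are [C_AbsRing], not [R_AbsRing]. *)
Definition holomorphic_on (U : C -> Prop) (f : C -> C) : Prop :=
  forall z, U z -> ex_derive (K := C_AbsRing) (V := C_NormedModule) f z.

Definition conformal_on (U : C -> Prop) (f : C -> C) : Prop :=
  holomorphic_on U f /\
  (forall z1 z2, U z1 -> U z2 -> f z1 = f z2 -> z1 = z2).

Definition conformal_onto (U V : C -> Prop) (f : C -> C) : Prop :=
  conformal_on U f /\
  (forall z, U z -> V (f z)) /\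
  (forall w, V w -> exists z, U z /\ f z = w).

Definition unit_interval (t : R) : Prop := 0 <= t <= 1.

Definition unit_square (u : R * R) : Prop :=
  unit_interval (fst u) /\ unit_interval (snd u).

Definition path_in (U : C -> Prop) (g : R -> C) : Prop :=
  continuous_on unit_interval g /\ (forall t, unit_interval t -> U (g t)).

Definition path_connected (U : C -> Prop) : Prop :=
  forall x y, U x -> U y -> exists g, path_in U g /\ g 0 = x /\ g 1 = y.

(** Every loop is homotopic, inside [U] and with fixed base point, to a
    constant loop; in [H (s, t)] the homotopy parameter is [s]. *)
Definition simply_connected (U : C -> Prop) : Prop :=
  path_connected U /\
  forall g, path_in U g -> g 0 = g 1 ->
    exists H : R * R -> C,
      continuous_on unit_square H /\
      (forall u, unit_square u -> U (H u)) /\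
      (forall t, unit_interval t -> H (0, t) = g t /\ H (1, t) = g 0) /\
      (forall s, unit_interval s -> H (s, 0) = g 0 /\ H (s, 1) = g 0).

Definition simply_connected_domain (U : C -> Prop) : Prop :=
  (exists z, U z) /\ open U /\ simply_connected U.

(** Principal argument, in (-PI, PI], of a nonzero complex number. *)
Definition Carg (w : C) : R :=
  if Rle_dec 0 (Im w) then acos (Re w / Cmod w) else - acos (Re w / Cmod w).

(** Principal branch of the n-th root ([w] nonzero, [n] positive). *)
Definition nroot (n : nat) (w : C) : C :=
  (Rpower (Cmod w) (/ INR n) * cos (Carg w / INR n),
   Rpower (Cmod w) (/ INR n) * sin (Carg w / INR n)).

(** The plane cut along the closed negative real axis, where [nroot n] is
    holomorphic. *)
Definition slit_plane (w : C) : Prop := 0 < Re w \/ Im w <> 0.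

(** * Parabolic germs *)

Definition iterate (m : nat) (f : C -> C) : C -> C := Nat.iter m f.

(** A germ is represented by a total function; only its values near 0 are
    constrained. *)
Record parabolic_germ (f : C -> C) (r0 : R) (p : Z) (q : nat) : Prop := {
  germ_radius : 0 < r0 < 1 / 2;
  germ_conformal : conformal_on (disk r0) f;
  germ_q_pos : (0 < q)%nat;
  germ_coprime : Z.gcd p (Z.of_nat q) = 1%Z;
  germ_taylor : exists c : nat -> C,
    c 0%nat = RtoC 0 /\
    c 1%nat = (cos (2 * PI * IZR p / INR q), sin (2 * PI * IZR p / INR q)) /\
    (forall z, disk r0 z -> is_pseries (K := C_AbsRing) (V := C_NormedModule) c z (f z));
  germ_infinite_order : forall m : nat, (0 < m)%nat ->
    ~ locally (RtoC 0 : C) (fun z : C => iterate m f z = z)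
}.

Record iterate_expansion (f : C -> C) (r0 : R) (q n : nat) (a : C) : Prop := {
  expansion_n_pos : (0 < n)%nat;
  expansion_n_multiple : Nat.divide q n;
  expansion_a_neq_0 : a <> RtoC 0;
  expansion_eq : exists (e : nat -> C) (eps : C -> C),
    (forall k, (k <= n)%nat -> e k = RtoC 0) /\
    (forall z, disk r0 z -> is_pseries (K := C_AbsRing) (V := C_NormedModule) e z (eps z)) /\
    (forall z, disk r0 z -> iterate q f z = (z * (1 + a * z ^ n + eps z))%C)
}.

Definition attracting_petal (f : C -> C) (r0 : R) (q : nat) (P : C -> Prop) : Prop :=
  exists r : R, 0 < r < r0 /\
    open P /\ simply_connected P /\
    (forall z, P z -> disk r z) /\
    (forall z, P z -> exists z', disk r z' /\ iterate q f z' = z) /\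
    (forall z, P z -> P (iterate q f z)) /\
    (forall eps, 0 < eps -> exists z, P z /\ Cmod z < eps) /\
    (forall eps, 0 < eps -> exists M : nat, forall (m : nat) (z : C),
       (M <= m)%nat -> P z -> Cmod (iterate m (iterate q f) z) < eps).

(** [d / z ^ n] with [d = - 1 / (n a)]. *)
Definition petal_coordinate (n : nat) (a z : C) : C :=
  (- / (INR n * a) / z ^ n)%C.

(** [phi_inv] is the conformal inverse, from a right half-plane onto the petal
    [P], of the coordinate [d / z ^ n]; it is a branch of the n-th root of
    [d / w]. *)
Definition petal_coordinate_inverse (n : nat) (a : C) (tau : R)
    (P : C -> Prop) (phi_inv : C -> C) : Prop :=
  conformal_onto (right_half_plane tau) P phi_inv /\
  (forall w, right_half_plane tau w ->
     petal_coordinate n a (phi_inv w) = w) /\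
  (forall z, P z -> phi_inv (petal_coordinate n a z) = z).

Definition perturbation_series (b : nat -> C) (r : R) (eta : C -> C) : Prop :=
  b 0%nat = RtoC 0 /\
  (forall xi, Cmod xi <= r ->
     is_pseries (K := C_AbsRing) (V := C_NormedModule) b xi (eta xi)).

Definition fatou_map (n : nat) (eta : C -> C) (w : C) : C :=
  (w + 1 + eta (/ nroot n w))%C.

(** The set on which [fatou_map n eta] is given by the principal branch and
    the values of [eta] in its disk of definition [|xi| <= r]. It contains the
    half-planes [Re w > tau] with [tau >= 1 / r ^ n], but is larger: the
    range of a linearizing map defined on a half-plane is in general not
    contained in any right half-plane on which [fatou_map] is defined. *)
Definition fatou_map_domain (n : nat) (r : R) (w : C) : Prop :=
  slit_plane w /\ Cmod (/ nroot n w)%C <= r.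

(* Main.v *)
Require Import Defs.
From Stdlib Require Import Reals ZArith Lra Lia ClassicalEpsilon.
From Coquelicot Require Import Coquelicot.
Open Scope R_scope.

(** Write F(w) = w + 1 + delta(w). On a sector Re w + |Im w| > T with T large,
    F moves points to the right by at least 1/2, while delta is small and has
    Lipschitz constant O(m^(-1-1/n)) on the part Re w + |Im w| > m. These
    constants are summable along orbits, so F^k(w) - F^k(w0) + w0 converges to
    a Fatou coordinate w + e(w) with e holomorphic and 1/4-Lipschitz on the
    whole sector, and it conjugates F to w + 1. The sector is needed because e
    may grow like a power of w or like log w: the image of a half-plane need
    not contain a half-plane, whereas, e being 1/4-Lipschitz, the image of the
    sector does, and Psi is the inverse of the coordinate there, precomposed
    with a translation (which is why the size of tau is irrelevant). *)

(** [delta] is in general only of order [w^(-1/n)], which is not summable along orbits; only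
    differences of [delta] gain the extra power. Hence estimates for pairs of points throughout.
    They cannot come from integrating a derivative bound along segments: the sector is the
    complement of a convex wedge, and a segment between two of its points may leave it. Lipschitz
    bounds are therefore proved directly, termwise for [eta] and in polar coordinates for the root,
    and they carry the rest: holomorphy of the limit, injectivity and surjectivity of the
    coordinate, and continuity of the homotopies in the image. Surjectivity is a contraction on a
    disk about the target whose radius is proportional to the distance from the base point, so it
    grows with the imaginary part; no right half-plane contains all these disks, while the wider
    sector has room for them. *)

(** * The complex derivative and its calculus *)

Lemma locally_Cmod (z : C) (P : C -> Prop) :
  locally (T := C_UniformSpace) z P <->
  exists d, 0 < d /\ forall w, Cmod (w - z) < d -> P w.
Proof.
  split.
  - intros [d Hd]. exists d. split; [apply cond_pos|]. intros w Hw.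
    apply Hd. apply C_NormedModule_mixin_compat1. exact Hw.
  - intros [d [Hd H]].
    (* Balls of [C_UniformSpace] are squares, and the square of half-side [d / sqrt 2] lies in the
       disk of radius [d]. *)
    assert (Hs : 0 < sqrt 2) by (apply sqrt_lt_R0; lra).
    assert (Hd' : 0 < d / sqrt 2) by (apply Rdiv_lt_0_compat; lra).
    exists (mkposreal _ Hd'). intros w Hw. apply H.
    apply C_NormedModule_mixin_compat2 in Hw.
    replace d with (sqrt 2 * (d / sqrt 2)) by (field; lra). exact Hw.
Qed.

(** Spelled out with [Cmod] because [C_UniformSpace] and the uniform structure
    of [C_AbsRing] are equivalent but not convertible. *)
Definition cderiv (f : C -> C) (z l : C) : Prop :=
  forall eps, 0 < eps -> exists d, 0 < d /\ forall w, Cmod (w - z) < d ->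
    Cmod (f w - f z - (w - z) * l) <= eps * Cmod (w - z).

(** The calculus below runs on [cderiv]; this is the passage back to the derivative in terms of
    which [holomorphic_on] is stated. *)
Lemma cderiv_is_derive (f : C -> C) (z l : C) :
  cderiv f z l <-> is_derive (K := C_AbsRing) (V := C_NormedModule) f z l.
Proof.
  split.
  - intros H. split.
    + apply is_linear_scal_l.
    + intros x Hx.
      assert (E : z = x) by (apply (is_filter_lim_locally_unique (V := AbsRing_NormedModule C_AbsRing) z x); exact Hx).
      subst x. intros eps. apply locally_C. apply locally_Cmod.
      destruct (H eps (cond_pos eps)) as [d [Hd Hw]].
      exists d. split; [exact Hd|]. intros w Hwd. exact (Hw w Hwd).
  - intros [_ H] eps Heps.
    assert (Hz : is_filter_lim (locally (T := AbsRing_UniformSpace C_AbsRing) z) z) by (intros P HP; exact HP).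
    specialize (H z Hz (mkposreal eps Heps)). apply locally_C, locally_Cmod in H.
    destruct H as [d [Hd Hw]]. exists d; split; [exact Hd|]. intros w Hwd. exact (Hw w Hwd).
Qed.

Lemma Cmod_sub_sym (a b : C) : Cmod (a - b) = Cmod (b - a).
Proof. replace (a - b)%C with (- (b - a))%C by ring. apply Cmod_opp. Qed.

Lemma Cmod_sub_triangle (a b c : C) : Cmod (a - c) <= Cmod (a - b) + Cmod (b - c).
Proof. replace (a - c)%C with ((a - b) + (b - c))%C by ring. apply Cmod_triangle. Qed.

Lemma cderiv_near (f g : C -> C) (z l : C) (d0 : R) :
  0 < d0 -> (forall w, Cmod (w - z) < d0 -> f w = g w) ->
  cderiv f z l -> cderiv g z l.
Proof.
  intros Hd0 E H eps Heps. destruct (H eps Heps) as [d [Hd Hw]].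
  exists (Rmin d d0). split; [apply Rmin_pos; assumption|]. intros w Hwd.
  rewrite <- (E w), <- (E z).
  - apply Hw. eapply Rlt_le_trans; [exact Hwd|apply Rmin_l].
  - replace (z - z)%C with (RtoC 0) by ring. rewrite Cmod_0. exact Hd0.
  - eapply Rlt_le_trans; [exact Hwd|apply Rmin_r].
Qed.

Lemma cderiv_const (c z : C) : cderiv (fun _ => c) z 0.
Proof.
  intros eps Heps. exists 1. split; [lra|]. intros w _.
  replace (c - c - (w - z) * 0)%C with (RtoC 0) by ring. rewrite Cmod_0.
  apply Rmult_le_pos; [lra|apply Cmod_ge_0].
Qed.

Lemma cderiv_id (z : C) : cderiv (fun w => w) z 1.
Proof.
  intros eps Heps. exists 1. split; [lra|]. intros w _.
  replace (w - z - (w - z) * 1)%C with (RtoC 0) by ring. rewrite Cmod_0.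
  apply Rmult_le_pos; [lra|apply Cmod_ge_0].
Qed.

Lemma cderiv_plus (f g : C -> C) (z l m : C) :
  cderiv f z l -> cderiv g z m -> cderiv (fun w => f w + g w)%C z (l + m).
Proof.
  intros Hf Hg eps Heps.
  destruct (Hf (eps / 2)) as [d1 [Hd1 H1]]; [lra|].
  destruct (Hg (eps / 2)) as [d2 [Hd2 H2]]; [lra|].
  exists (Rmin d1 d2). split; [apply Rmin_pos; assumption|]. intros w Hw.
  specialize (H1 w (Rlt_le_trans _ _ _ Hw (Rmin_l _ _))).
  specialize (H2 w (Rlt_le_trans _ _ _ Hw (Rmin_r _ _))).
  replace (f w + g w - (f z + g z) - (w - z) * (l + m))%C
    with ((f w - f z - (w - z) * l) + (g w - g z - (w - z) * m))%C by ring.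
  eapply Rle_trans; [apply Cmod_triangle|]. lra.
Qed.

Lemma cderiv_scal (c : C) (f : C -> C) (z l : C) :
  cderiv f z l -> cderiv (fun w => c * f w)%C z (c * l).
Proof.
  intros Hf eps Heps.
  pose proof (Cmod_ge_0 c) as Hc.
  destruct (Hf (eps / (Cmod c + 1))) as [d [Hd H]]; [apply Rdiv_lt_0_compat; lra|].
  exists d. split; [assumption|]. intros w Hw. specialize (H w Hw).
  replace (c * f w - c * f z - (w - z) * (c * l))%C
    with (c * (f w - f z - (w - z) * l))%C by ring.
  rewrite Cmod_mult.
  apply Rle_trans with (Cmod c * (eps / (Cmod c + 1) * Cmod (w - z))).
  - apply Rmult_le_compat_l; assumption.
  - replace (Cmod c * (eps / (Cmod c + 1) * Cmod (w - z)))
      with ((Cmod c / (Cmod c + 1)) * (eps * Cmod (w - z))) by (field; lra).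
    rewrite <- (Rmult_1_l (eps * _)) at 2. apply Rmult_le_compat_r.
    + apply Rmult_le_pos; [lra|apply Cmod_ge_0].
    + apply Rmult_le_reg_r with (Cmod c + 1); [lra|]. field_simplify; lra.
Qed.

Lemma cderiv_lip (f : C -> C) (z l : C) :
  cderiv f z l -> exists d, 0 < d /\ forall w, Cmod (w - z) < d ->
    Cmod (f w - f z) <= (Cmod l + 1) * Cmod (w - z).
Proof.
  intros H. destruct (H 1 Rlt_0_1) as [d [Hd Hw]]. exists d. split; [assumption|].
  intros w Hwd. specialize (Hw w Hwd).
  replace (f w - f z)%C with ((f w - f z - (w - z) * l) + (w - z) * l)%C by ring.
  eapply Rle_trans; [apply Cmod_triangle|]. rewrite Cmod_mult. lra.
Qed.

Lemma cderiv_comp (f g : C -> C) (z l m : C) :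
  cderiv f z l -> cderiv g (f z) m -> cderiv (fun w => g (f w)) z (l * m).
Proof.
  intros Hf Hg eps Heps.
  pose proof (Cmod_ge_0 l) as Hl. pose proof (Cmod_ge_0 m) as Hm.
  destruct (cderiv_lip f z l Hf) as [d0 [Hd0 H0]].
  destruct (Hg (eps / 2 / (Cmod l + 1))) as [d2 [Hd2 H2]].
  { repeat apply Rdiv_lt_0_compat; lra. }
  destruct (Hf (eps / 2 / (Cmod m + 1))) as [d1 [Hd1 H1]].
  { repeat apply Rdiv_lt_0_compat; lra. }
  assert (Hd3 : 0 < d2 / (Cmod l + 1)) by (apply Rdiv_lt_0_compat; lra).
  exists (Rmin (Rmin d0 d1) (d2 / (Cmod l + 1))).
  split; [repeat apply Rmin_pos; assumption|]. intros w Hw.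
  pose proof (Rlt_le_trans _ _ _ Hw (Rmin_r _ _)) as Hw3.
  pose proof (Rlt_le_trans _ _ _ (Rlt_le_trans _ _ _ Hw (Rmin_l _ _)) (Rmin_l _ _)) as Hw0.
  pose proof (Rlt_le_trans _ _ _ (Rlt_le_trans _ _ _ Hw (Rmin_l _ _)) (Rmin_r _ _)) as Hw1.
  specialize (H0 w Hw0). specialize (H1 w Hw1).
  assert (Hfw : Cmod (f w - f z) < d2).
  { eapply Rle_lt_trans; [exact H0|].
    replace d2 with ((Cmod l + 1) * (d2 / (Cmod l + 1))) by (field; lra).
    apply Rmult_lt_compat_l; lra. }
  specialize (H2 (f w) Hfw).
  replace (g (f w) - g (f z) - (w - z) * (l * m))%C
    with ((g (f w) - g (f z) - (f w - f z) * m) + (f w - f z - (w - z) * l) * m)%C by ring.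
  eapply Rle_trans; [apply Cmod_triangle|]. rewrite Cmod_mult.
  pose proof (Cmod_ge_0 (w - z)) as Hx.
  assert (A1 : eps / 2 / (Cmod l + 1) * Cmod (f w - f z) <= eps / 2 * Cmod (w - z)).
  { replace (eps / 2 * Cmod (w - z)) with (eps / 2 / (Cmod l + 1) * ((Cmod l + 1) * Cmod (w - z))) by (field; lra).
    apply Rmult_le_compat_l; [|exact H0]. apply Rlt_le. repeat apply Rdiv_lt_0_compat; lra. }
  assert (A2 : Cmod (f w - f z - (w - z) * l) * Cmod m <= eps / 2 * Cmod (w - z)).
  { apply Rle_trans with (eps / 2 / (Cmod m + 1) * Cmod (w - z) * (Cmod m + 1)).
    - apply Rmult_le_compat; try apply Cmod_ge_0; lra.
    - right. field. lra. }
  lra.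
Qed.

Lemma cderiv_mult (f g : C -> C) (z l m : C) :
  cderiv f z l -> cderiv g z m -> cderiv (fun w => f w * g w)%C z (l * g z + f z * m).
Proof.
  intros Hf Hg eps Heps.
  pose proof (Cmod_ge_0 (f z)) as Hfz. pose proof (Cmod_ge_0 (g z)) as Hgz.
  pose proof (Cmod_ge_0 l) as Hl. pose proof (Cmod_ge_0 m) as Hm.
  destruct (cderiv_lip f z l Hf) as [d0 [Hd0 H0]].
  destruct (cderiv_lip g z m Hg) as [d0' [Hd0' H0']].
  destruct (Hf (eps / 3 / (Cmod (g z) + 1))) as [d1 [Hd1 H1]].
  { repeat apply Rdiv_lt_0_compat; lra. }
  destruct (Hg (eps / 3 / (Cmod (f z) + 1))) as [d2 [Hd2 H2]].
  { repeat apply Rdiv_lt_0_compat; lra. }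
  set (K := (Cmod l + 1) * (Cmod m + 1)).
  assert (HK : 0 < K) by (apply Rmult_lt_0_compat; lra).
  assert (Hd3 : 0 < eps / 3 / K) by (repeat apply Rdiv_lt_0_compat; lra).
  exists (Rmin (Rmin (Rmin d0 d0') (Rmin d1 d2)) (eps / 3 / K)).
  split; [repeat apply Rmin_pos; assumption|]. intros w Hw.
  pose proof (Rlt_le_trans _ _ _ Hw (Rmin_r _ _)) as Hw3.
  apply (fun H => Rlt_le_trans _ _ _ H (Rmin_l _ _)) in Hw.
  pose proof (Rlt_le_trans _ _ _ Hw (Rmin_r _ _)) as Hw4.
  apply (fun H => Rlt_le_trans _ _ _ H (Rmin_l _ _)) in Hw.
  specialize (H0 w (Rlt_le_trans _ _ _ Hw (Rmin_l _ _))).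
  specialize (H0' w (Rlt_le_trans _ _ _ Hw (Rmin_r _ _))).
  specialize (H1 w (Rlt_le_trans _ _ _ Hw4 (Rmin_l _ _))).
  specialize (H2 w (Rlt_le_trans _ _ _ Hw4 (Rmin_r _ _))).
  replace (f w * g w - f z * g z - (w - z) * (l * g z + f z * m))%C
    with ((f w - f z) * (g w - g z) + (f w - f z - (w - z) * l) * g z
          + (g w - g z - (w - z) * m) * f z)%C by ring.
  eapply Rle_trans; [apply Cmod_triangle|].
  eapply Rle_trans; [apply Rplus_le_compat_r, Cmod_triangle|]. rewrite !Cmod_mult.
  pose proof (Cmod_ge_0 (w - z)) as Hx.
  assert (A1 : Cmod (f w - f z - (w - z) * l) * Cmod (g z) <= eps / 3 * Cmod (w - z)).
  { apply Rle_trans with (eps / 3 / (Cmod (g z) + 1) * Cmod (w - z) * (Cmod (g z) + 1)).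
    - apply Rmult_le_compat; try apply Cmod_ge_0; lra.
    - right. field. lra. }
  assert (A2 : Cmod (g w - g z - (w - z) * m) * Cmod (f z) <= eps / 3 * Cmod (w - z)).
  { apply Rle_trans with (eps / 3 / (Cmod (f z) + 1) * Cmod (w - z) * (Cmod (f z) + 1)).
    - apply Rmult_le_compat; try apply Cmod_ge_0; lra.
    - right. field. lra. }
  assert (A3 : Cmod (f w - f z) * Cmod (g w - g z) <= eps / 3 * Cmod (w - z)).
  { apply Rle_trans with ((Cmod l + 1) * Cmod (w - z) * ((Cmod m + 1) * Cmod (w - z))).
    - apply Rmult_le_compat; try apply Cmod_ge_0; lra.
    - replace ((Cmod l + 1) * Cmod (w - z) * ((Cmod m + 1) * Cmod (w - z)))
        with (K * Cmod (w - z) * Cmod (w - z)) by (unfold K; ring).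
      apply Rmult_le_compat_r; [exact Hx|].
      replace (eps / 3) with (K * (eps / 3 / K)) by (field; lra).
      apply Rmult_le_compat_l; lra. }
  lra.
Qed.

Lemma cderiv_pow (k : nat) (z : C) :
  cderiv (fun w => w ^ k)%C z (INR k * z ^ pred k)%C.
Proof.
  induction k as [|k IH].
  - simpl (INR 0). rewrite Cmult_0_l. apply (cderiv_const 1).
  - pose proof (cderiv_mult _ _ z _ _ (cderiv_id z) IH) as H. simpl in H.
    replace (INR (S k) * z ^ pred (S k))%C
      with (1 * z ^ k + z * (INR k * z ^ pred k))%C; [exact H|].
    rewrite S_INR, RtoC_plus. destruct k as [|k].
    + simpl. ring.
    + simpl pred. rewrite Cpow_S. ring.
Qed.

(** Inserting [f w] into the expansion of [g] at [f z] gives [w - z = (f w - f z) l + o(f w - f z)],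
    and the Lipschitz bound on [f] turns the error into [o(w - z)]. This takes the place of an
    inverse function theorem, both for the root and for [Psi]. *)
Lemma cderiv_inverse (f g : C -> C) (z l : C) (K d0 : R) :
  l <> RtoC 0 -> cderiv g (f z) l -> 0 < d0 ->
  (forall w, Cmod (w - z) < d0 ->
     g (f w) = w /\ Cmod (f w - f z) <= K * Cmod (w - z)) ->
  cderiv f z (/ l).
Proof.
  intros Hl Hg Hd0 Hf eps Heps.
  pose proof (proj1 (Cmod_gt_0 l) Hl) as Hml.
  set (K1 := Rabs K + 1).
  assert (HK1 : 0 < K1) by (unfold K1; pose proof (Rabs_pos K); lra).
  destruct (Hg (eps * Cmod l / K1)) as [d [Hd H]].
  { apply Rdiv_lt_0_compat; [apply Rmult_lt_0_compat|]; lra. }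
  assert (Hd1 : 0 < d / K1) by (apply Rdiv_lt_0_compat; lra).
  exists (Rmin d0 (d / K1)). split; [apply Rmin_pos; assumption|]. intros w Hw.
  destruct (Hf w (Rlt_le_trans _ _ _ Hw (Rmin_l _ _))) as [Egw Hlip].
  destruct (Hf z) as [Egz _].
  { replace (z - z)%C with (RtoC 0) by ring. rewrite Cmod_0. exact Hd0. }
  pose proof (Rlt_le_trans _ _ _ Hw (Rmin_r _ _)) as Hw1.
  pose proof (Cmod_ge_0 (w - z)) as Hx.
  assert (Hlip1 : Cmod (f w - f z) <= K1 * Cmod (w - z)).
  { eapply Rle_trans; [exact Hlip|]. apply Rmult_le_compat_r; [exact Hx|].
    unfold K1. pose proof (RRle_abs K). lra. }
  assert (Hfd : Cmod (f w - f z) < d).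
  { eapply Rle_lt_trans; [exact Hlip1|].
    replace d with (K1 * (d / K1)) by (field; lra). apply Rmult_lt_compat_l; assumption. }
  specialize (H (f w) Hfd). rewrite Egw, Egz in H.
  replace (f w - f z - (w - z) * / l)%C
    with (- (w - z - (f w - f z) * l) * / l)%C by (field; assumption).
  rewrite Cmod_mult, Cmod_opp, Cmod_inv by assumption.
  apply Rmult_le_reg_r with (Cmod l); [assumption|].
  rewrite Rmult_assoc, Rinv_l, Rmult_1_r by lra.
  eapply Rle_trans; [exact H|].
  apply Rle_trans with (eps * Cmod l / K1 * (K1 * Cmod (w - z))).
  - apply Rmult_le_compat_l; [|exact Hlip1]. apply Rlt_le.
    apply Rdiv_lt_0_compat; [apply Rmult_lt_0_compat|]; lra.
  - right. field. lra.
Qed.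

Lemma cderiv_Cinv (z : C) : z <> RtoC 0 -> cderiv Cinv z (- / (z * z)).
Proof.
  intros Hz eps Heps.
  pose proof (proj1 (Cmod_gt_0 z) Hz) as Hm. set (M := Cmod z) in *.
  (* The remainder is exactly [(w - z)^2 / (w z^2)]. The first bound keeps [Cmod w >= M / 2], and
     the second then makes the remainder at most [eps * Cmod (w - z)]. *)
  exists (Rmin (M / 2) (eps * M * M * M / 2)).
  split.
  { apply Rmin_pos; [lra|]. apply Rdiv_lt_0_compat; [|lra].
    repeat apply Rmult_lt_0_compat; assumption. }
  intros w Hw.
  pose proof (Rlt_le_trans _ _ _ Hw (Rmin_l _ _)) as Hw1.
  pose proof (Rlt_le_trans _ _ _ Hw (Rmin_r _ _)) as Hw2.
  assert (Hwm : M / 2 <= Cmod w).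
  { pose proof (Cmod_triangle w (z - w)) as T.
    replace (w + (z - w))%C with z in T by ring. rewrite (Cmod_sub_sym z w) in T. fold M in T. lra. }
  assert (Hw0 : w <> RtoC 0) by (apply Cmod_gt_0; lra).
  replace (/ w - / z - (w - z) * - / (z * z))%C
    with ((w - z) * (w - z) * / (w * (z * z)))%C by (field; split; assumption).
  assert (Hzz : (z * z)%C <> RtoC 0) by (apply Cmult_neq_0; assumption).
  rewrite !Cmod_mult, Cmod_inv by (apply Cmult_neq_0; assumption).
  rewrite !Cmod_mult. fold M.
  pose proof (Cmod_ge_0 (w - z)) as Hx.
  assert (HwM : 0 < Cmod w) by lra.
  rewrite (Rmult_comm eps), Rmult_assoc. apply Rmult_le_compat_l; [exact Hx|].
  apply Rmult_le_reg_r with (Cmod w * (M * M)).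
  { repeat apply Rmult_lt_0_compat; assumption. }
  rewrite Rmult_assoc, Rinv_l by (apply Rgt_not_eq; repeat apply Rmult_lt_0_compat; assumption).
  rewrite Rmult_1_r.
  apply Rle_trans with (eps * M * M * M / 2); [lra|].
  replace (eps * M * M * M / 2) with (eps * (M / 2 * (M * M))) by field.
  apply Rmult_le_compat_l; [lra|]. apply Rmult_le_compat_r; [|assumption].
  apply Rlt_le, Rmult_lt_0_compat; assumption.
Qed.

(** * Complex series and termwise differentiation *)

Notation is_cseries := (is_series (K := C_AbsRing) (V := C_NormedModule)).
Notation csum := (sum_n (G := C_AbelianGroup)).

Lemma csum_S (a : nat -> C) (n : nat) : csum a (S n) = (csum a n + a (S n))%C.
Proof. exact (sum_Sn (G := C_AbelianGroup) a n). Qed.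

Lemma csum_O (a : nat -> C) : csum a 0 = a 0%nat.
Proof. exact (sum_O (G := C_AbelianGroup) a). Qed.

Lemma rsum_S (a : nat -> R) (n : nat) : sum_n a (S n) = sum_n a n + a (S n).
Proof. exact (sum_Sn a n). Qed.

Lemma is_cseries_eps (a : nat -> C) (l : C) :
  is_cseries a l <->
  forall eps, 0 < eps -> exists N, forall n, (N <= n)%nat -> Cmod (csum a n - l) < eps.
Proof.
  unfold is_series. rewrite (filterlim_locally_ball_norm (K := C_AbsRing) (U := C_NormedModule)).
  split.
  - intros H eps Heps. exact (H (mkposreal eps Heps)).
  - intros H eps. exact (H eps (cond_pos eps)).
Qed.

Lemma is_cseries_minus (a b : nat -> C) (la lb : C) :
  is_cseries a la -> is_cseries b lb -> is_cseries (fun k => a k - b k)%C (la - lb)%C.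
Proof. exact (is_series_minus (K := C_AbsRing) (V := C_NormedModule) a b la lb). Qed.

Lemma Cmod_csum_le (a : nat -> C) (c : nat -> R) (n m : nat) :
  (forall k, Cmod (a k) <= c k) -> (n <= m)%nat ->
  Cmod (csum a m - csum a n) <= sum_n c m - sum_n c n.
Proof.
  intros H Hnm. induction Hnm as [|m Hnm IH].
  - replace (csum a n - csum a n)%C with (RtoC 0) by ring. rewrite Cmod_0. lra.
  - rewrite csum_S, rsum_S.
    replace (csum a m + a (S m) - csum a n)%C
      with ((csum a m - csum a n) + a (S m))%C by ring.
    eapply Rle_trans; [apply Cmod_triangle|]. specialize (H (S m)). lra.
Qed.

Lemma sum_n_le_series (c : nat -> R) (L : R) (n : nat) :
  (forall k, 0 <= c k) -> is_series c L -> sum_n c n <= L.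
Proof.
  intros Hc HL.
  apply (is_lim_seq_incr_compare (sum_n c) L HL).
  intros k. rewrite rsum_S. specialize (Hc (S k)). lra.
Qed.

Lemma cseries_tail_le (a : nat -> C) (c : nat -> R) (l : C) (L : R) (n : nat) :
  (forall k, Cmod (a k) <= c k) -> is_series c L -> is_cseries a l ->
  Cmod (l - csum a n) <= L - sum_n c n.
Proof.
  intros H HL Hl.
  apply Rle_plus_epsilon. intros eps Heps.
  destruct (proj1 (is_cseries_eps a l) Hl eps Heps) as [N HN].
  specialize (HN (max n N) (Nat.le_max_r _ _)).
  pose proof (Cmod_csum_le a c n (max n N) H (Nat.le_max_l _ _)) as A.
  assert (B : sum_n c (max n N) <= L).
  { apply sum_n_le_series; [|exact HL]. intros k. eapply Rle_trans; [apply Cmod_ge_0|apply H]. }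
  pose proof (Cmod_sub_triangle l (csum a (max n N)) (csum a n)) as T.
  rewrite (Cmod_sub_sym l (csum a (max n N))) in T. lra.
Qed.

Lemma cseries_norm_le (a : nat -> C) (c : nat -> R) (l : C) (L : R) :
  (forall k, Cmod (a k) <= c k) -> is_series c L -> is_cseries a l -> Cmod l <= L.
Proof.
  intros H HL Hl. pose proof (cseries_tail_le a c l L 0 H HL Hl) as T.
  rewrite csum_O, sum_O in T. specialize (H 0%nat).
  pose proof (Cmod_triangle (l - a 0%nat) (a 0%nat)) as A.
  replace (l - a 0%nat + a 0%nat)%C with l in A by ring. lra.
Qed.

(** Two uses: the derivatives of the terms of a series inherit the summable bounds, and the
    derivative of [e] is too small to cancel the [1] in that of [w + e w]. *)
Lemma cderiv_lipschitz_le (f : C -> C) (z l : C) (d c : R) :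
  0 < d -> (forall w, Cmod (w - z) < d -> Cmod (f w - f z) <= c * Cmod (w - z)) ->
  cderiv f z l -> Cmod l <= c.
Proof.
  intros Hd Hf H. apply Rle_plus_epsilon. intros eps Heps.
  destruct (H eps Heps) as [d1 [Hd1 H1]].
  set (h := Rmin d d1 / 2).
  assert (Hm : 0 < Rmin d d1) by (apply Rmin_pos; assumption).
  assert (Hh : 0 < h) by (unfold h; lra).
  assert (Hh1 : h < d) by (unfold h; pose proof (Rmin_l d d1); lra).
  assert (Hh2 : h < d1) by (unfold h; pose proof (Rmin_r d d1); lra).
  assert (E : (z + h - z)%C = RtoC h) by ring.
  assert (Eh : Cmod (RtoC h) = h) by (rewrite Cmod_R; apply Rabs_pos_eq; lra).
  specialize (Hf (z + h)%C). specialize (H1 (z + h)%C). rewrite E, Eh in *.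
  specialize (Hf Hh1). specialize (H1 Hh2).
  apply Rmult_le_reg_l with h; [exact Hh|].
  replace (h * Cmod l) with (Cmod (h * l)) by (rewrite Cmod_mult, Eh; reflexivity).
  pose proof (Cmod_sub_triangle (h * l) (f (z + h) - f z)%C 0) as T.
  rewrite (Cmod_sub_sym (h * l) (f (z + h)%C - f z)) in T.
  replace (f (z + h)%C - f z - 0)%C with (f (z + h)%C - f z)%C in T by ring.
  replace (h * l - 0)%C with (h * l)%C in T by ring. lra.
Qed.

Lemma cderiv_csum (t : nat -> C -> C) (z : C) (l : nat -> C) (n : nat) :
  (forall k, cderiv (t k) z (l k)) ->
  cderiv (fun w => csum (fun k => t k w) n) z (csum l n).
Proof.
  intros H. induction n as [|n IH].
  - rewrite csum_O. apply (cderiv_near (t 0%nat) _ z _ 1 Rlt_0_1); [|apply H].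
    intros w _. symmetry. apply (csum_O (fun k => t k w)).
  - rewrite csum_S.
    apply (cderiv_near (fun w => csum (fun k => t k w) n + t (S n) w)%C _ z _ 1 Rlt_0_1).
    + intros w _. symmetry. apply (csum_S (fun k => t k w)).
    + apply cderiv_plus; [exact IH|apply H].
Qed.

(** The Lipschitz constants dominate the derivatives, so their summability is
    what allows termwise differentiation, without Cauchy's formula. *)
Lemma lipschitz_series (U : C -> Prop) (t : nat -> C -> C) (c : nat -> R) (L : R) (z0 : C) :
  U z0 -> (forall k, t k z0 = RtoC 0) -> (forall k, 0 <= c k) ->
  (forall k w w', U w -> U w' -> Cmod (t k w - t k w') <= c k * Cmod (w - w')) ->
  is_series c L ->
  exists f : C -> C,
    (forall w, U w -> is_cseries (fun k => t k w) (f w)) /\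
    (forall w w', U w -> U w' -> Cmod (f w - f w') <= L * Cmod (w - w')) /\
    (forall z d, 0 < d -> (forall w, Cmod (w - z) < d -> U w) ->
       (forall k, exists l, cderiv (t k) z l) -> exists l, cderiv f z l).
Proof.
  intros Uz0 Ht0 Hc Hlip HL.
  assert (Hscal : forall x, is_series (fun k => c k * x) (L * x)).
  { intros x. apply is_series_scal_r. exact HL. }
  set (f := fun w => epsilon (inhabits (RtoC 0)) (fun l => is_cseries (fun k => t k w) l)).
  (* Vanishing at [z0] turns the Lipschitz bounds into summable bounds on the terms themselves. *)
  assert (Hf : forall w, U w -> is_cseries (fun k => t k w) (f w)).
  { intros w Uw. unfold f. apply epsilon_spec.
    apply (ex_series_le (K := C_AbsRing) (V := C_CompleteNormedModule) _
             (fun k => c k * Cmod (w - z0))).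
    - intros k. pose proof (Hlip k w z0 Uw Uz0) as H. rewrite Ht0 in H.
      replace (t k w - 0)%C with (t k w) in H by ring. exact H.
    - exists (L * Cmod (w - z0)). apply Hscal. }
  (* The remainder after [n] terms is again Lipschitz, with the tail of [c] as its constant, so
     difference quotients converge uniformly in the increment. *)
  assert (Htail : forall n w w', U w -> U w' ->
     Cmod (f w - f w' - (csum (fun k => t k w) n - csum (fun k => t k w') n))
       <= (L - sum_n c n) * Cmod (w - w')).
  { intros n w w' Uw Uw'.
    pose proof (cseries_tail_le (fun k => t k w - t k w')%C _ _ _ n
       (fun k => Hlip k w w' Uw Uw') (Hscal _)
       (is_cseries_minus _ _ _ _ (Hf w Uw) (Hf w' Uw'))) as T.
    replace (csum (fun k => t k w) n - csum (fun k => t k w') n)%C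
      with (csum (fun k => t k w - t k w')%C n).
    - replace ((L - sum_n c n) * Cmod (w - w'))
        with (L * Cmod (w - w') - sum_n (fun k => c k * Cmod (w - w')) n); [exact T|].
      rewrite (sum_n_mult_r (K := R_Ring)). exact (eq_sym (Rmult_minus_distr_r _ _ _)).
    - clear. induction n as [|n IH]; [rewrite !csum_O; reflexivity|].
      rewrite !csum_S, IH. refine (_ : @eq C _ _). ring. }
  exists f. split; [exact Hf|]. split.
  - intros w w' Uw Uw'.
    exact (cseries_norm_le (fun k => t k w - t k w')%C _ _ _
       (fun k => Hlip k w w' Uw Uw') (Hscal _)
       (is_cseries_minus _ _ _ _ (Hf w Uw) (Hf w' Uw'))).
  - intros z d Hd HU Hder.
    assert (Uz : U z).
    { apply HU. replace (z - z)%C with (RtoC 0) by ring. rewrite Cmod_0. exact Hd. }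
    set (l := fun k => epsilon (inhabits (RtoC 0)) (fun l => cderiv (t k) z l)).
    assert (Hl : forall k, cderiv (t k) z (l k)).
    { intros k. unfold l. apply epsilon_spec, Hder. }
    assert (Hlc : forall k, Cmod (l k) <= c k).
    { intros k. apply (cderiv_lipschitz_le (t k) z _ d); [exact Hd| |apply Hl].
      intros w Hw. apply Hlip; auto. }
    assert (Hex : exists m, is_cseries l m).
    { apply (ex_series_le (K := C_AbsRing) (V := C_CompleteNormedModule) _ c); [exact Hlc|].
      exists L. exact HL. }
    destruct Hex as [m Hm]. exists m. intros eps Heps.
    assert (Hn : exists n, L - sum_n c n < eps / 3).
    { destruct (proj1 (filterlim_locally_ball_norm (K := R_AbsRing) (U := R_NormedModule) _ _) HL
        (mkposreal (eps / 3) ltac:(lra))) as [n Hn].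
      exists n. specialize (Hn n (Nat.le_refl n)).
      change (Rabs (sum_n c n - L) < eps / 3) in Hn.
      apply Rabs_def2 in Hn. lra. }
    destruct Hn as [n Hn].
    destruct (cderiv_csum t z l n Hl (eps / 3)) as [d1 [Hd1 H1]]; [lra|].
    exists (Rmin d d1). split; [apply Rmin_pos; assumption|]. intros w Hw.
    specialize (H1 w (Rlt_le_trans _ _ _ Hw (Rmin_r _ _))).
    specialize (Htail n w z (HU w (Rlt_le_trans _ _ _ Hw (Rmin_l _ _))) Uz).
    pose proof (cseries_tail_le l c m L n Hlc HL Hm) as Hml.
    set (S := csum (fun k => t k w) n) in *. set (S' := csum (fun k => t k z) n) in *.
    set (s := csum l n) in *. pose proof (Cmod_ge_0 (w - z)) as Hx.
    (* Three errors of [eps / 3]: the remainder of the function series, the differentiation of the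
       partial sum, and the remainder of the series of derivatives. *)
    replace (f w - f z - (w - z) * m)%C
      with ((f w - f z - (S - S')) + (S - S' - (w - z) * s) + (w - z) * - (m - s))%C by ring.
    eapply Rle_trans; [apply Cmod_triangle|].
    eapply Rle_trans; [apply Rplus_le_compat_r, Cmod_triangle|].
    rewrite Cmod_mult, Cmod_opp.
    assert ((L - sum_n c n) * Cmod (w - z) <= eps / 3 * Cmod (w - z)) by (apply Rmult_le_compat_r; lra).
    assert (Cmod (w - z) * Cmod (m - s) <= eps / 3 * Cmod (w - z)).
    { rewrite Rmult_comm. apply Rmult_le_compat_r; lra. }
    lra.
Qed.

(** * Regularity of the perturbation series *)

Lemma is_cseries_unique (a : nat -> C) (l m : C) :
  is_cseries a l -> is_cseries a m -> l = m.
Proof.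
  intros H1 H2.
  exact (filterlim_locally_unique (K := C_AbsRing) (V := C_NormedModule) _ l m H1 H2).
Qed.

Lemma is_cseries_0 (a : nat -> C) : (forall k, a k = RtoC 0) -> is_cseries a (RtoC 0).
Proof.
  intros H. apply is_cseries_eps. intros eps Heps. exists 0%nat. intros n _.
  replace (csum a n) with (RtoC 0).
  - replace (0 - 0)%C with (RtoC 0) by ring. rewrite Cmod_0. exact Heps.
  - induction n as [|n IH]; [rewrite csum_O, H; reflexivity|].
    rewrite csum_S, <- IH, H. ring.
Qed.

Lemma cseries_terms_bounded (a : nat -> C) (l : C) :
  is_cseries a l -> exists B, forall k, Cmod (a k) <= B.
Proof.
  intros H.
  destruct (filterlim_bounded (K := C_AbsRing) (V := C_NormedModule) (csum a)
    (ex_intro _ l H)) as [M HM].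
  change (forall n, Cmod (csum a n) <= M) in HM.
  exists (2 * M). intros [|k].
  - rewrite <- csum_O. pose proof (HM 0%nat). pose proof (Cmod_ge_0 (csum a 0)). lra.
  - replace (a (S k)) with (csum a (S k) + - csum a k)%C by (rewrite csum_S; ring).
    eapply Rle_trans; [apply Cmod_triangle|]. rewrite Cmod_opp.
    pose proof (HM k). pose proof (HM (S k)). lra.
Qed.

(** The usual factor [k s^(k-1)], multiplied through by [s] so that neither a predecessor nor a
    division enters the induction. *)
Lemma Cpow_lipschitz (s : R) (z w : C) (k : nat) :
  Cmod z <= s -> Cmod w <= s ->
  Cmod (z ^ k - w ^ k) * s <= INR k * s ^ k * Cmod (z - w).
Proof.
  intros Hz Hw. assert (Hs : 0 <= s) by (eapply Rle_trans; [apply Cmod_ge_0|exact Hz]).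
  induction k as [|k IH].
  - simpl. replace (1 - 1)%C with (RtoC 0) by ring. rewrite Cmod_0. lra.
  - replace (z ^ S k - w ^ S k)%C with (z * (z ^ k - w ^ k) + (z - w) * w ^ k)%C
      by (simpl; ring).
    eapply Rle_trans; [apply Rmult_le_compat_r; [exact Hs|apply Cmod_triangle]|].
    rewrite !Cmod_mult, Cmod_pow, S_INR. simpl.
    assert (A : Cmod z * (Cmod (z ^ k - w ^ k) * s) <= s * (INR k * s ^ k * Cmod (z - w))).
    { apply Rmult_le_compat; try assumption; try apply Cmod_ge_0.
      apply Rmult_le_pos; [apply Cmod_ge_0|exact Hs]. }
    assert (B : Cmod w ^ k <= s ^ k) by (apply pow_incr; split; [apply Cmod_ge_0|exact Hw]).
    assert (D : Cmod (z - w) * s * Cmod w ^ k <= Cmod (z - w) * s * s ^ k).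
    { apply Rmult_le_compat_l; [|exact B]. apply Rmult_le_pos; [apply Cmod_ge_0|exact Hs]. }
    nra.
Qed.

Lemma INR_le_pow2 (k : nat) : INR k <= 2 ^ k.
Proof.
  induction k as [|k IH]; [simpl; lra|]. rewrite S_INR. simpl.
  pose proof (pow_R1_Rle 2 k). lra.
Qed.

(** Convergence at the single point [r] bounds [r^k * Cmod (b k)] by some [B]. On the disk of radius
    [r / 4] the [k]-th term then has Lipschitz constant at most [(4 B / r) k 4^(-k)], and [k <= 2^k]
    leaves a geometric series of ratio [1 / 2]. *)
Lemma perturbation_series_regular (b : nat -> C) (r : R) (eta : C -> C) :
  0 < r -> perturbation_series b r eta ->
  eta 0 = RtoC 0 /\
  exists K, 0 < K /\
    (forall x y, disk (r / 4) x -> disk (r / 4) y ->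
       Cmod (eta x - eta y) <= K * Cmod (x - y)) /\
    (forall x, disk (r / 4) x -> exists l, cderiv eta x l).
Proof.
  intros Hr [Hb0 Heta].
  assert (Heta' : forall x, Cmod x <= r -> is_cseries (fun k => x ^ k * b k)%C (eta x)).
  { intros x Hx.
    apply (is_series_ext (K := C_AbsRing) (V := C_NormedModule)
      (fun k => scal (pow_n x k) (b k) : C_NormedModule)); [|exact (Heta x Hx)].
    intros k. reflexivity. }
  destruct (cseries_terms_bounded _ _ (Heta' r ltac:(rewrite Cmod_R, Rabs_pos_eq; lra)))
    as [B HB].
  assert (HB' : forall k, r ^ k * Cmod (b k) <= B).
  { intros k. specialize (HB k). rewrite Cmod_mult, Cmod_pow, Cmod_R, Rabs_pos_eq in HB; lra. }
  assert (HB0 : 0 <= B) by (eapply Rle_trans; [apply Cmod_ge_0|apply (HB 0%nat)]).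
  set (K := 4 * (B + 1) / r). assert (HK : 0 < K) by (unfold K; apply Rdiv_lt_0_compat; lra).
  set (c := fun k => K * (1 / 2) ^ k).
  assert (HL : is_series c (K * / (1 - 1 / 2))).
  { apply (is_series_scal (K := R_AbsRing) (V := R_NormedModule) K (fun k => (1 / 2) ^ k)). apply is_series_geom. rewrite Rabs_pos_eq; lra. }
  assert (H0 : disk (r / 4) 0) by (unfold disk; rewrite Cmod_0; lra).
  destruct (lipschitz_series (disk (r / 4)) (fun k x => x ^ k * b k)%C c (K * / (1 - 1 / 2)) 0 H0)
    as [f [Hf [Hlip Hder]]]; [ | | |exact HL| ].
  - intros [|k]; [rewrite Hb0; ring|]. simpl. ring.
  - intros k. unfold c. apply Rmult_le_pos; [lra|]. apply pow_le. lra.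
  - intros k x y Hx Hy. unfold disk in *.
    replace (x ^ k * b k - y ^ k * b k)%C with ((x ^ k - y ^ k) * b k)%C by ring.
    rewrite Cmod_mult.
    pose proof (Cpow_lipschitz (r / 4) x y k ltac:(lra) ltac:(lra)) as P.
    pose proof (INR_le_pow2 k) as P2. specialize (HB' k).
    pose proof (Cmod_ge_0 (x - y)) as Hd. pose proof (Cmod_ge_0 (b k)) as Hb.
    unfold c, K.
    assert (E : (r / 4) ^ k = r ^ k * (1 / 4) ^ k) by (rewrite <- Rpow_mult_distr; f_equal; lra).
    assert (E2 : (1 / 2) ^ k = 2 ^ k * (1 / 4) ^ k) by (rewrite <- Rpow_mult_distr; f_equal; lra).
    rewrite E in P. rewrite E2.
    assert (Hq : 0 <= (1 / 4) ^ k) by (apply pow_le; lra).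
    apply Rmult_le_reg_r with (r / 4); [lra|].
    apply Rle_trans with (INR k * (r ^ k * (1 / 4) ^ k) * Cmod (x - y) * Cmod (b k)).
    { replace (Cmod (x ^ k - y ^ k) * Cmod (b k) * (r / 4))
        with (Cmod (x ^ k - y ^ k) * (r / 4) * Cmod (b k)) by ring.
      apply Rmult_le_compat_r; assumption. }
    replace (4 * (B + 1) / r * (2 ^ k * (1 / 4) ^ k) * Cmod (x - y) * (r / 4))
      with (2 ^ k * ((1 / 4) ^ k * Cmod (x - y) * (B + 1))) by (field; lra).
    replace (INR k * (r ^ k * (1 / 4) ^ k) * Cmod (x - y) * Cmod (b k))
      with (INR k * ((1 / 4) ^ k * Cmod (x - y) * (r ^ k * Cmod (b k)))) by ring.
    apply Rmult_le_compat; [apply pos_INR| |exact P2|].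
    + repeat apply Rmult_le_pos; try assumption. apply pow_le. lra.
    + apply Rmult_le_compat_l; [apply Rmult_le_pos; assumption|lra].
  - assert (Ef : forall x, disk (r / 4) x -> f x = eta x).
    { intros x Hx. apply (is_cseries_unique (fun k => x ^ k * b k)%C); [apply Hf; exact Hx|].
      apply Heta'. unfold disk in Hx. lra. }
    split.
    { apply (is_cseries_unique (fun k => RtoC 0 ^ k * b k)%C).
      - apply Heta'. rewrite Cmod_0. lra.
      - apply is_cseries_0. intros [|k]; [rewrite Hb0; ring|]. simpl. ring. }
    exists (K * / (1 - 1 / 2)). split; [|split].
    + apply Rmult_lt_0_compat; [exact HK|]. apply Rinv_0_lt_compat. lra.
    + intros x y Hx Hy. rewrite <- (Ef x Hx), <- (Ef y Hy). apply Hlip; assumption.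
    + intros x Hx. unfold disk in Hx.
      assert (Hnear : forall w, Cmod (w - x) < r / 4 - Cmod x -> disk (r / 4) w).
      { intros w Hw. unfold disk. pose proof (Cmod_triangle (w - x) x) as T.
        replace (w - x + x)%C with w in T by ring. lra. }
      destruct (Hder x (r / 4 - Cmod x) ltac:(lra) Hnear) as [l Hl].
      { intros k. eexists.
        apply (cderiv_near (fun w => b k * w ^ k)%C _ x _ 1 Rlt_0_1); [intros; ring|].
        apply cderiv_scal, cderiv_pow. }
      exists l. apply (cderiv_near f eta x l (r / 4 - Cmod x)); [lra| |exact Hl].
      intros w Hw. apply Ef, Hnear, Hw.
Qed.

(** * Polar coordinates and arguments in the sector *)

Definition polar (s t : R) : C := (s * cos t, s * sin t).

Lemma polar_pow (s t : R) (k : nat) : (polar s t ^ k)%C = polar (s ^ k) (INR k * t).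
Proof.
  induction k as [|k IH].
  - simpl. unfold polar. rewrite Rmult_0_l, cos_0, sin_0. apply injective_projections; simpl; ring.
  - rewrite Cpow_S, IH, S_INR. unfold polar.
    replace ((INR k + 1) * t) with (t + INR k * t) by ring.
    rewrite cos_plus, sin_plus. apply injective_projections; simpl; ring.
Qed.

Lemma Cmod_polar (s t : R) : 0 <= s -> Cmod (polar s t) = s.
Proof.
  intros Hs. unfold Cmod, polar; simpl.
  replace (s * cos t * (s * cos t * 1) + s * sin t * (s * sin t * 1))
    with (s ^ 2 * (Rsqr (sin t) + Rsqr (cos t))) by (unfold Rsqr; ring).
  rewrite sin2_cos2, Rmult_1_r. apply sqrt_pow2. exact Hs.
Qed.

Lemma Cinv_polar (s t : R) : 0 < s -> (/ polar s t)%C = polar (/ s) (- t).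
Proof.
  intros Hs.
  assert (H : (polar s t * polar (/ s) (- t))%C = RtoC 1).
  { unfold polar. rewrite cos_neg, sin_neg. pose proof (sin2_cos2 t) as E. unfold Rsqr in E.
    apply injective_projections; simpl.
    - replace (s * cos t * (/ s * cos t) - s * sin t * (/ s * - sin t))
        with (sin t * sin t + cos t * cos t) by (field; lra). exact E.
    - field. lra. }
  assert (H0 : polar s t <> RtoC 0).
  { apply Cmod_gt_0. rewrite Cmod_polar; lra. }
  replace (polar (/ s) (- t)) with (/ polar s t * (polar s t * polar (/ s) (- t)))%C
    by (field; exact H0).
  rewrite H. ring.
Qed.

(** The law of cosines in half-angle form. It splits a squared distance into a radial and an angular
    part, which can be compared separately before and after taking roots. *)
Lemma Cmod_polar_sub (s s' t t' : R) :
  Cmod (polar s t - polar s' t') ^ 2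
    = (s - s') ^ 2 + 4 * (s * s') * sin ((t - t') / 2) ^ 2.
Proof.
  rewrite Cmod2_alt. unfold polar; simpl.
  replace (4 * (s * s') * (sin ((t - t') / 2) * (sin ((t - t') / 2) * 1)))
    with (2 * (s * s') * (1 - cos (t - t'))).
  - rewrite cos_minus. pose proof (sin2_cos2 t). pose proof (sin2_cos2 t'). unfold Rsqr in *.
    nra.
  - replace (t - t') with (2 * ((t - t') / 2)) at 1 by field. rewrite cos_2a_sin. ring.
Qed.

Lemma Carg_polar (w : C) : w <> RtoC 0 -> w = polar (Cmod w) (Carg w).
Proof.
  intros Hw. pose proof (proj1 (Cmod_gt_0 w) Hw) as Hm.
  set (x := Re w / Cmod w).
  assert (Hx : -1 <= x <= 1).
  { pose proof (re_le_Cmod w) as H. apply Rabs_le_between in H. unfold x.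
    split; apply Rmult_le_reg_r with (Cmod w); try exact Hm;
      unfold Rdiv; rewrite Rmult_assoc, Rinv_l; lra. }
  assert (Hre : Cmod w * x = Re w) by (unfold x; field; lra).
  assert (Hs : Cmod w * sqrt (1 - x ^ 2) = Rabs (Im w)).
  { rewrite <- (sqrt_pow2 (Cmod w)) at 1 by lra. rewrite <- sqrt_mult_alt by apply pow2_ge_0.
    rewrite <- sqrt_Rsqr_abs. f_equal. pose proof (Cmod2_alt w) as E. unfold Rsqr.
    replace (Cmod w ^ 2 * (1 - x ^ 2)) with (Cmod w ^ 2 - (Cmod w * x) ^ 2) by ring.
    rewrite Hre, E. ring. }
  unfold Carg, polar. fold x.
  assert (Hsin : sin (acos x) = sqrt (1 - x ^ 2)).
  { rewrite sin_acos by exact Hx. f_equal. unfold Rsqr. ring. }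
  destruct (Rle_dec 0 (Im w)) as [Hi|Hi].
  - rewrite cos_acos by exact Hx. rewrite Hsin, Hre, Hs, Rabs_pos_eq by exact Hi.
    apply injective_projections; reflexivity.
  - rewrite cos_neg, sin_neg, cos_acos by exact Hx.
    replace (Cmod w * - sin (acos x)) with (- (Cmod w * sin (acos x))) by ring.
    rewrite Hsin, Hre, Hs, Rabs_left by lra.
    apply injective_projections; simpl; [reflexivity|]. unfold Im. ring.
Qed.

(** [sector 0] is the set of arguments of modulus less than 3 pi / 4. *)
Definition height (w : C) : R := Re w + Rabs (Im w).
Definition sector (T : R) (w : C) : Prop := T < height w.

Lemma im_le_Cmod (w : C) : Rabs (Im w) <= Cmod w.
Proof. exact (Rle_trans _ _ _ (Rmax_r _ _) (Rmax_Cmod w)). Qed.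

Lemma height_le_Cmod (w : C) : height w <= 2 * Cmod w.
Proof.
  unfold height. pose proof (im_le_Cmod w). pose proof (re_le_Cmod w).
  pose proof (RRle_abs (Re w)). lra.
Qed.

Lemma height_lipschitz (w z : C) : Rabs (height w - height z) <= 2 * Cmod (w - z).
Proof.
  pose proof (im_le_Cmod (w - z)) as Hi. pose proof (re_le_Cmod (w - z)) as Hr.
  unfold height.
  replace (Re (w - z)) with (Re w - Re z) in Hr by reflexivity.
  replace (Im (w - z)) with (Im w - Im z) in Hi by reflexivity.
  pose proof (Rabs_triang_inv2 (Im w) (Im z)) as T.
  replace (Re w + Rabs (Im w) - (Re z + Rabs (Im z)))
    with ((Re w - Re z) + (Rabs (Im w) - Rabs (Im z))) by ring.
  eapply Rle_trans; [apply Rabs_triang|]. lra.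
Qed.

(** With [t] the absolute value of the argument, [height w] is [Cmod w] times [cos t + sin t], a
    positive multiple of [cos (t - PI / 4)], which is nonpositive once [t] passes [3 PI / 4]. *)
Lemma Carg_sector (w : C) : sector 0 w -> Rabs (Carg w) <= 3 * (PI / 4).
Proof.
  intros Hw. unfold sector in Hw.
  assert (Hm : 0 < Cmod w) by (pose proof (height_le_Cmod w); lra).
  assert (E : w = polar (Cmod w) (Carg w)) by (apply Carg_polar, Cmod_gt_0; exact Hm).
  pose proof (acos_bound (Re w / Cmod w)) as Hb. set (t := acos (Re w / Cmod w)) in *.
  assert (Et : Rabs (Carg w) = t).
  { unfold Carg. fold t. destruct (Rle_dec 0 (Im w)); [|rewrite Rabs_Ropp]; apply Rabs_pos_eq; lra. }
  assert (Hh : height w = Cmod w * (cos t + sin t)).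
  { rewrite <- Et. unfold height. rewrite E at 1 2. unfold polar; simpl.
    assert (Hsin : 0 <= sin (Rabs (Carg w))) by (rewrite Et; apply sin_ge_0; lra).
    rewrite Rabs_mult, (Rabs_pos_eq (Cmod w)) by lra.
    unfold Rabs in Hsin |- * at 2 3. revert Hsin. destruct (Rcase_abs (Carg w)); intros Hsin.
    - rewrite cos_neg. rewrite sin_neg in Hsin |- *.
      replace (Rabs (sin (Carg w))) with (- sin (Carg w)); [ring|].
      rewrite <- Rabs_Ropp. symmetry. apply Rabs_pos_eq. exact Hsin.
    - rewrite Rabs_pos_eq by exact Hsin. ring. }
  rewrite Et. destruct (Rle_or_lt t (3 * (PI / 4))) as [H|H]; [exact H|exfalso].
  pose proof PI_RGT_0 as HPI.
  assert (Hc : cos (t - PI / 4) <= 0) by (apply cos_le_0; lra).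
  rewrite cos_minus, cos_PI4, sin_PI4 in Hc.
  assert (Hs2 : 0 < 1 / sqrt 2) by (apply Rdiv_lt_0_compat; [lra|apply sqrt_lt_R0; lra]).
  assert (Hp : 0 < cos t + sin t).
  { apply Rmult_lt_reg_l with (Cmod w); [exact Hm|]. rewrite <- Hh, Rmult_0_r. exact Hw. }
  nra.
Qed.

(** * Bounds for the sine and for real powers *)

Lemma Rabs_sin_le (x : R) : Rabs (sin x) <= Rabs x.
Proof.
  destruct (MVT_gen sin 0 x cos) as [c [_ Hc]].
  - intros y _. apply is_derive_Reals, derivable_pt_lim_sin.
  - intros y _. apply continuity_sin.
  - rewrite sin_0, !Rminus_0_r in Hc. rewrite Hc, Rabs_mult.
    rewrite <- (Rmult_1_l (Rabs x)) at 2. apply Rmult_le_compat_r; [apply Rabs_pos|].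
    apply Rabs_le. pose proof (COS_bound c). lra.
Qed.

(** Half the difference of two arguments from the sector may exceed [PI / 2], where the cosine is
    negative, so the mean value theorem for [sin] on [[0, x]] gives no positive lower bound. Writing
    [sin x = 2 sin (x / 2) cos (x / 2)] keeps all cosines at least [k = cos (3 PI / 8)]; hence the
    constant [k * k]. *)
Lemma Rabs_sin_ge :
  exists c, 0 < c <= 1 /\ forall x, Rabs x <= 3 * (PI / 4) -> c * Rabs x <= Rabs (sin x).
Proof.
  pose proof PI_RGT_0 as HPI.
  set (k := cos (3 * (PI / 8))).
  assert (Hk : 0 < k) by (apply cos_gt_0; lra).
  assert (Hk1 : k <= 1) by (pose proof (COS_bound (3 * (PI / 8))); unfold k; lra).
  assert (Hpos : forall x, 0 <= x <= 3 * (PI / 4) -> k * k * x <= sin x).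
  { intros x Hx.
    assert (Hcos : forall y, 0 <= y <= 3 * (PI / 8) -> k <= cos y).
    { intros y Hy. apply cos_decr_1; lra. }
    assert (Hsin : k * (x / 2) <= sin (x / 2)).
    { destruct (MVT_gen sin 0 (x / 2) cos) as [c [Hc E]].
      - intros y _. apply is_derive_Reals, derivable_pt_lim_sin.
      - intros y _. apply continuity_sin.
      - rewrite sin_0, !Rminus_0_r in E. rewrite E. rewrite Rmin_left, Rmax_right in Hc by lra.
        apply Rmult_le_compat_r; [lra|]. apply Hcos. lra. }
    specialize (Hcos (x / 2) ltac:(lra)).
    replace x with (2 * (x / 2)) at 2 by field. rewrite sin_2a.
    pose proof (Rmult_le_compat (k * (x / 2)) (sin (x / 2)) k (cos (x / 2))
      ltac:(apply Rmult_le_pos; lra) ltac:(lra) Hsin Hcos). lra. }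
  exists (k * k). split; [nra|]. intros x Hx.
  destruct (Rle_or_lt 0 x) as [H|H].
  - rewrite Rabs_pos_eq in * by exact H. eapply Rle_trans; [apply Hpos; lra|apply RRle_abs].
  - rewrite (Rabs_left x) in * by exact H. rewrite <- (Rabs_Ropp (sin x)), <- sin_neg.
    eapply Rle_trans; [apply Hpos; lra|apply RRle_abs].
Qed.

Lemma Rpower_anti (al x y : R) : 0 <= al -> 0 < x <= y -> Rpower y (- al) <= Rpower x (- al).
Proof.
  intros Hal [Hx Hxy]. rewrite !Rpower_Ropp. apply Rinv_le_contravar; [apply exp_pos|].
  apply Rle_Rpower_l; lra.
Qed.

Lemma Rpower_MVT (al x y : R) : 0 < x <= y ->
  exists c, x <= c <= y /\ Rpower y (- al) - Rpower x (- al) = - al * Rpower c (- (1 + al)) * (y - x).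
Proof.
  intros [Hx Hxy].
  destruct (MVT_gen (fun t => Rpower t (- al)) x y (fun t => - al * Rpower t (- (1 + al))))
    as [c [Hc E]]; rewrite Rmin_left, Rmax_right in * by lra.
  - intros t Ht. apply is_derive_Reals.
    replace (- (1 + al)) with (- al - 1) by ring. apply derivable_pt_lim_power. lra.
  - intros t Ht. apply derivable_continuous_pt. eexists. apply derivable_pt_lim_power. lra.
  - exists c. split; [lra|exact E].
Qed.

Lemma Rpower_lipschitz (al mu x y : R) : 0 < al <= 1 -> 0 < mu -> mu <= x -> mu <= y ->
  Rabs (Rpower x (- al) - Rpower y (- al)) <= Rpower mu (- (1 + al)) * Rabs (x - y).
Proof.
  intros Hal Hmu.
  assert (W : forall x y, mu <= x -> x <= y ->
    Rabs (Rpower x (- al) - Rpower y (- al)) <= Rpower mu (- (1 + al)) * Rabs (x - y)).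
  { clear x y. intros x y Hx Hxy.
    destruct (Rpower_MVT al x y ltac:(lra)) as [c [Hc E]].
    rewrite Rabs_minus_sym, E, !Rabs_mult, Rabs_Ropp, (Rabs_minus_sym y).
    apply Rmult_le_compat_r; [apply Rabs_pos|].
    rewrite (Rabs_pos_eq al), (Rabs_pos_eq (Rpower c _)) by (try apply Rlt_le, exp_pos; lra).
    rewrite <- (Rmult_1_l (Rpower mu _)).
    apply Rmult_le_compat; try (apply Rlt_le, exp_pos); try lra.
    apply Rpower_anti; lra. }
  intros Hx Hy. destruct (Rle_or_lt x y) as [H|H]; [apply W; assumption|].
  rewrite Rabs_minus_sym, (Rabs_minus_sym x). apply W; lra.
Qed.

Lemma Rpower_tends_0 (al eps : R) : 0 < al -> 0 < eps ->
  exists M, 0 < M /\ forall x, M <= x -> Rpower x (- al) <= eps.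
Proof.
  intros Hal Heps. exists (Rpower eps (- / al)). split; [apply exp_pos|].
  intros x Hx. apply Rle_trans with (Rpower (Rpower eps (- / al)) (- al)).
  - apply Rpower_anti; [lra|]. split; [apply exp_pos|exact Hx].
  - rewrite Rpower_mult. replace (- / al * - al) with 1 by (field; lra).
    rewrite Rpower_1 by exact Heps. lra.
Qed.

(** * The inverse root on the sector *)

Lemma INR_inv_bounds (n : nat) : (0 < n)%nat -> 0 < / INR n <= 1.
Proof.
  intros n_pos. assert (1 <= INR n) by (apply (le_INR 1); lia).
  split; [apply Rinv_0_lt_compat; lra|]. rewrite <- Rinv_1. apply Rinv_le_contravar; lra.
Qed.

Lemma inv_nroot_polar (n : nat) (w : C) :
  (/ nroot n w)%C = polar (Rpower (Cmod w) (- / INR n)) (- (Carg w / INR n)).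
Proof.
  change (nroot n w) with (polar (Rpower (Cmod w) (/ INR n)) (Carg w / INR n)).
  rewrite Cinv_polar by apply exp_pos. rewrite Rpower_Ropp. reflexivity.
Qed.

Lemma Cmod_inv_nroot (n : nat) (w : C) : Cmod (/ nroot n w) = Rpower (Cmod w) (- / INR n).
Proof. rewrite inv_nroot_polar. apply Cmod_polar, Rlt_le, exp_pos. Qed.

Lemma inv_nroot_pow (n : nat) (w : C) : (0 < n)%nat -> w <> RtoC 0 -> (/ (/ nroot n w) ^ n)%C = w.
Proof.
  intros n_pos Hw. pose proof (proj1 (Cmod_gt_0 w) Hw) as Hm.
  assert (HnR : 0 < INR n) by (apply (lt_INR 0); lia).
  rewrite inv_nroot_polar, polar_pow, Cinv_polar by apply pow_lt, exp_pos.
  rewrite (Carg_polar w Hw) at 3. f_equal.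
  - rewrite <- Rpower_pow, Rpower_mult by apply exp_pos.
    rewrite <- Rpower_Ropp. replace (- (- / INR n * INR n)) with 1 by (field; lra).
    apply Rpower_1. exact Hm.
  - field. lra.
Qed.

(** In the sector two arguments differ by at most 3 pi / 2, so the chord
    controls the difference of the arguments. *)
Lemma inv_nroot_lipschitz (n : nat) : (0 < n)%nat ->
  exists K, 0 < K /\ forall mu a b, 0 < mu -> sector 0 a -> sector 0 b ->
    mu <= Cmod a -> mu <= Cmod b ->
    Cmod (/ nroot n a - / nroot n b) <= K * Rpower mu (- (1 + / INR n)) * Cmod (a - b).
Proof.
  intros n_pos. destruct Rabs_sin_ge as [c [Hc Hsin]]. exists (/ c).
  split; [apply Rinv_0_lt_compat; lra|]. intros mu a b Hmu Ha Hb Hma Hmb.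
  pose proof (INR_inv_bounds n n_pos) as Hn. set (al := / INR n) in *.
  assert (Ha0 : a <> RtoC 0) by (apply Cmod_gt_0; lra).
  assert (Hb0 : b <> RtoC 0) by (apply Cmod_gt_0; lra).
  pose proof (Carg_sector a Ha) as Aa. pose proof (Carg_sector b Hb) as Ab.
  rewrite (inv_nroot_polar n a), (inv_nroot_polar n b). fold al.
  rewrite (Carg_polar a Ha0) at 3. rewrite (Carg_polar b Hb0) at 3.
  set (s := Cmod a) in *. set (s' := Cmod b) in *. set (t := Carg a) in *. set (t' := Carg b) in *.
  set (L := Rpower mu (- (1 + al))). assert (HL : 0 < L) by apply exp_pos.
  apply Rsqr_incr_0_var.
  2:{ repeat apply Rmult_le_pos; try apply Cmod_ge_0; try lra. apply Rlt_le, Rinv_0_lt_compat; lra. }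
  unfold Rsqr.
  replace (/ c * L * Cmod (polar s t - polar s' t') * (/ c * L * Cmod (polar s t - polar s' t')))
    with (L ^ 2 * (Cmod (polar s t - polar s' t') ^ 2 / c ^ 2)) by (field; lra).
  match goal with |- ?X * ?X <= _ => replace (X * X) with (X ^ 2) by ring end.
  rewrite !Cmod_polar_sub.
  set (x := (t - t') / 2).
  replace ((- (t / INR n) - - (t' / INR n)) / 2) with (- (al * x))
    by (unfold x, al; field; apply not_0_INR; lia).
  assert (Hx : Rabs x <= 3 * (PI / 4)).
  { unfold x, Rdiv. rewrite Rabs_mult, (Rabs_pos_eq (/ 2)) by lra.
    pose proof (Rabs_triang t (- t')) as T. rewrite Rabs_Ropp in T. unfold Rminus. lra. }
  assert (H1 : (Rpower s (- al) - Rpower s' (- al)) ^ 2 <= L ^ 2 * (s - s') ^ 2).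
  { rewrite <- (pow2_abs (_ - _)), <- (pow2_abs (s - s')), <- Rpow_mult_distr.
    apply pow_incr. split; [apply Rabs_pos|]. apply Rpower_lipschitz; assumption. }
  (* Multiplying the half-difference [x] by [al <= 1] shrinks it, so the left sine is at most [|x|];
     the lower bound [c |x| <= |sin x|] then returns to the sine of the original angle. *)
  assert (H2 : sin (- (al * x)) ^ 2 <= sin x ^ 2 / c ^ 2).
  { rewrite <- (pow2_abs (sin (- _))), <- (pow2_abs (sin x)).
    apply Rle_trans with (Rabs x ^ 2).
    - apply pow_incr. split; [apply Rabs_pos|]. eapply Rle_trans; [apply Rabs_sin_le|].
      rewrite Rabs_Ropp, Rabs_mult, (Rabs_pos_eq al) by lra.
      rewrite <- (Rmult_1_l (Rabs x)) at 2. apply Rmult_le_compat_r; [apply Rabs_pos|lra].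
    - replace (Rabs x ^ 2) with ((c * Rabs x) ^ 2 / c ^ 2) by (field; lra).
      apply Rmult_le_compat_r; [apply Rlt_le, Rinv_0_lt_compat, pow_lt; lra|].
      apply pow_incr. split; [apply Rmult_le_pos; [lra|apply Rabs_pos]|apply Hsin, Hx]. }
  (* Since [s^(-al) = s^(-(1 + al)) s], the product of the two radii acquires the same factor
     [L ^ 2] as the radial part. *)
  assert (H3 : Rpower s (- al) * Rpower s' (- al) <= L ^ 2 * (s * s')).
  { assert (E : forall y, mu <= y -> Rpower y (- al) <= L * y).
    { intros y Hy. replace (- al) with (- (1 + al) + 1) by ring.
      rewrite Rpower_plus, Rpower_1 by lra. apply Rmult_le_compat_r; [lra|].
      apply Rpower_anti; lra. }
    replace (L ^ 2 * (s * s')) with (L * s * (L * s')) by ring.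
    apply Rmult_le_compat; try (apply Rlt_le, exp_pos); apply E; assumption. }
  assert (Hc2 : 1 <= / c ^ 2).
  { rewrite <- Rinv_1. apply Rinv_le_contravar; [apply pow_lt; lra|]. nra. }
  assert (Hss : 0 <= s * s') by (apply Rmult_le_pos; lra).
  apply Rle_trans with (L ^ 2 * (s - s') ^ 2 * / c ^ 2
      + 4 * (L ^ 2 * (s * s')) * (sin x ^ 2 / c ^ 2)).
  - apply Rplus_le_compat.
    + eapply Rle_trans; [exact H1|].
      rewrite <- (Rmult_1_r (L ^ 2 * (s - s') ^ 2)) at 1. apply Rmult_le_compat_l; [|exact Hc2].
      apply Rmult_le_pos; apply pow2_ge_0.
    + apply Rmult_le_compat; [|apply pow2_ge_0|lra|exact H2].
      pose proof (exp_pos (- al * ln s)). pose proof (exp_pos (- al * ln s')).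
      unfold Rpower. apply Rmult_le_pos; [lra|]. apply Rmult_le_pos; lra.
  - right. field. lra.
Qed.

(** Polar coordinates need not be differentiated: the inverse root has the left inverse
    [v -> 1 / v^n], whose derivative does not vanish, and its own Lipschitz bound is what
    [cderiv_inverse] asks for. *)
Lemma inv_nroot_cderiv (n : nat) (a : C) : (0 < n)%nat ->
  sector 0 a -> exists l, cderiv (fun w => / nroot n w)%C a l.
Proof.
  intros n_pos Ha. unfold sector in Ha.
  assert (Hm : 0 < Cmod a) by (pose proof (height_le_Cmod a); lra).
  destruct (inv_nroot_lipschitz n n_pos) as [K [HK Hlip]].
  set (u := (/ nroot n a)%C).
  assert (Hu : u <> RtoC 0).
  { apply Cmod_gt_0. unfold u. rewrite Cmod_inv_nroot. apply exp_pos. }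
  assert (Hun : (u ^ n)%C <> RtoC 0) by (apply Cpow_nz; exact Hu).
  pose proof (cderiv_comp (fun v => v ^ n)%C Cinv u _ _ (cderiv_pow n u) (cderiv_Cinv _ Hun)) as Hg.
  (* [height] is 2-Lipschitz and at most [2 * Cmod], so the radius [height a / 4] keeps [w] in
     [sector 0] and [Cmod w] at least [Cmod a / 2]. *)
  eexists. eapply (cderiv_inverse _ (fun v => / v ^ n)%C a _
    (K * Rpower (Cmod a / 2) (- (1 + / INR n))) (height a / 4)); [|exact Hg|lra|].
  - repeat apply Cmult_neq_0.
    + intros E. apply RtoC_inj in E. apply not_0_INR in E; [exact E|lia].
    + apply Cpow_nz. exact Hu.
    + intros E. apply (Cmult_neq_0 (u ^ n) (u ^ n) Hun Hun).
      replace (u ^ n * u ^ n)%C with (- (- / (u ^ n * u ^ n)) * ((u ^ n * u ^ n) * (u ^ n * u ^ n)))%C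
        by (field; exact Hun).
      rewrite E. ring.
  - intros w Hw. pose proof (height_lipschitz w a) as Hh. apply Rabs_le_between in Hh.
    assert (Hw0 : sector 0 w) by (unfold sector; lra).
    pose proof (height_le_Cmod a) as Hha. pose proof (height_le_Cmod w) as Hhw.
    unfold sector in Hw0.
    split.
    + apply inv_nroot_pow, Cmod_gt_0; [exact n_pos|lra].
    + apply Hlip; try assumption; try lra.
      pose proof (Cmod_triangle w (a - w)) as T. replace (w + (a - w))%C with a in T by ring.
      rewrite (Cmod_sub_sym a w) in T. lra.
Qed.

(** * Summation along orbits and the Fatou coordinate *)

(** A discrete integral comparison: each term is at most [4 / al] times the drop of [x^(-al)] over
    the preceding interval of length [1 / 4], and the drops telescope. The step is [1 / 4] because
    one iteration raises the lower bound on [height] by [1 / 2], and [Cmod] is at least half of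
    [height]. *)
Lemma Rpower_series (al s : R) : 0 < al -> 1 / 4 < s ->
  exists L, is_series (fun k => Rpower (s + INR k / 4) (- (1 + al))) L /\
    L <= 4 / al * Rpower (s - 1 / 4) (- al).
Proof.
  intros Hal Hs. set (u := fun k => Rpower (s + INR k / 4) (- (1 + al))).
  assert (Hu : forall k, 0 <= u k) by (intros k; apply Rlt_le, exp_pos).
  assert (Hpart : forall n, sum_n u n <=
    4 / al * (Rpower (s - 1 / 4) (- al) - Rpower (s + INR n / 4) (- al))).
  { assert (Hstep : forall x, 1 / 4 < x ->
      Rpower x (- (1 + al)) <= 4 / al * (Rpower (x - 1 / 4) (- al) - Rpower x (- al))).
    { intros x Hx. destruct (Rpower_MVT al (x - 1 / 4) x ltac:(lra)) as [c [Hc E]].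
      replace (Rpower (x - 1 / 4) (- al) - Rpower x (- al)) with (al * Rpower c (- (1 + al)) * (1 / 4))
        by lra.
      replace (4 / al * (al * Rpower c (- (1 + al)) * (1 / 4))) with (Rpower c (- (1 + al)))
        by (field; lra).
      apply Rpower_anti; lra. }
    intros n. induction n as [|n IH].
    - rewrite sum_O. unfold u. simpl INR. replace (s + 0 / 4) with s by field. apply Hstep. exact Hs.
    - rewrite rsum_S. specialize (Hstep (s + INR (S n) / 4)).
      rewrite S_INR in *. pose proof (pos_INR n) as Hn. specialize (Hstep ltac:(lra)).
      replace (s + (INR n + 1) / 4 - 1 / 4) with (s + INR n / 4) in Hstep by field.
      unfold u at 2. rewrite S_INR. lra. }
  assert (Hbound : forall n, sum_n u n <= 4 / al * Rpower (s - 1 / 4) (- al)).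
  { intros n. eapply Rle_trans; [apply Hpart|]. apply Rmult_le_compat_l.
    - apply Rlt_le, Rdiv_lt_0_compat; lra.
    - assert (0 < Rpower (s + INR n / 4) (- al)) by apply exp_pos. lra. }
  destruct (ex_finite_lim_seq_incr (sum_n u) (4 / al * Rpower (s - 1 / 4) (- al))) as [L HL].
  - intros n. rewrite rsum_S. specialize (Hu (S n)). lra.
  - exact Hbound.
  - exists L. split; [exact HL|].
    exact (is_lim_seq_le _ _ L (4 / al * Rpower (s - 1 / 4) (- al)) Hbound HL (is_lim_seq_const _)).
Qed.

(** Translation by [1] gains [1] in height; as [height] is 2-Lipschitz, [d] takes back at most
    [1 / 2]. This is the origin of the threshold [1 / 4] for [delta]. *)
Lemma sector_translate (m : R) (w d : C) :
  sector m w -> Cmod d <= 1 / 4 -> sector (m + 1 / 2) (w + 1 + d).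
Proof.
  unfold sector. intros Hw Hd.
  pose proof (height_lipschitz (w + 1 + d) (w + 1)) as H.
  replace (w + 1 + d - (w + 1))%C with d in H by ring. apply Rabs_le_between in H.
  assert (height (w + 1)%C = height w + 1).
  { unfold height, Re, Im. simpl. rewrite Rplus_0_r. ring. }
  lra.
Qed.

Lemma sector_open (m : R) (w : C) :
  sector m w -> exists d, 0 < d /\ forall z, Cmod (z - w) < d -> sector m z.
Proof.
  unfold sector. intros Hw. exists ((height w - m) / 2). split; [lra|]. intros z Hz.
  pose proof (height_lipschitz z w) as H. apply Rabs_le_between in H. lra.
Qed.

(** The Fatou coordinate [w + e w] is the limit of [F^k w - F^k w0 + w0],
    written as a telescoping series. *)
Lemma fatou_coordinate (delta : C -> C) (T L : R) (om : nat -> R) (w0 : C) :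
  (forall w, sector T w -> Cmod (delta w) <= 1 / 4) ->
  (forall k, 0 <= om k) ->
  (forall k a b, sector (T + INR k / 2) a -> sector (T + INR k / 2) b ->
     Cmod (delta a - delta b) <= om k * Cmod (a - b)) ->
  is_series om L -> L <= 1 / 8 ->
  (forall w, sector T w -> exists l, cderiv delta w l) ->
  (forall eps, 0 < eps -> exists M, forall w, sector M w -> Cmod (delta w) < eps) ->
  sector T w0 ->
  exists e : C -> C,
    e w0 = RtoC 0 /\
    (forall a b, sector T a -> sector T b -> Cmod (e a - e b) <= 1 / 4 * Cmod (a - b)) /\
    (forall w, sector T w -> exists l, cderiv e w l) /\
    (forall w, sector T w -> (e (w + 1 + delta w) = e w - delta w)%C).
Proof.
  intros Hd4 Hom Hlip HL HL8 Hder Hlim Hw0.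
  set (F := fun w => (w + 1 + delta w)%C).
  assert (Hsec : forall k w, sector T w -> sector (T + INR k / 2) (iterate k F w)).
  { intros k w Hw. induction k as [|k IH].
    - simpl. replace (T + 0 / 2) with T by field. exact Hw.
    - change (iterate (S k) F w) with (F (iterate k F w)). rewrite S_INR.
      replace (T + (INR k + 1) / 2) with (T + INR k / 2 + 1 / 2) by field.
      apply sector_translate; [exact IH|]. apply Hd4. unfold sector in *.
      pose proof (pos_INR k). lra. }
  assert (Hsec0 : forall k w, sector T w -> sector T (iterate k F w)).
  { intros k w Hw. specialize (Hsec k w Hw). unfold sector in *. pose proof (pos_INR k). lra. }
  assert (HFk : forall k a b, sector T a -> sector T b ->
    Cmod (iterate k F a - iterate k F b) <= 2 * Cmod (a - b)).
  { intros k a b Ha Hb. pose proof (Cmod_ge_0 (a - b)) as Hab.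
    (* The product of the factors [1 + om k] stays below [1 + 2 * sum_n om k]: the induction closes
       because the partial sums are at most [1 / 8]. *)
    assert (HS : forall k, Cmod (iterate (S k) F a - iterate (S k) F b)
                           <= (1 + 2 * sum_n om k) * Cmod (a - b)).
    { assert (Hstep : forall k, Cmod (iterate (S k) F a - iterate (S k) F b)
          <= (1 + om k) * Cmod (iterate k F a - iterate k F b)).
      { intros j.
        change (iterate (S j) F a) with (iterate j F a + 1 + delta (iterate j F a))%C.
        change (iterate (S j) F b) with (iterate j F b + 1 + delta (iterate j F b))%C.
        specialize (Hlip j _ _ (Hsec j a Ha) (Hsec j b Hb)).
        set (x := iterate j F a) in *. set (y := iterate j F b) in *.
        replace (x + 1 + delta x - (y + 1 + delta y))%C
          with ((x - y) + (delta x - delta y))%C by ring.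
        eapply Rle_trans; [apply Cmod_triangle|]. lra. }
      intros j. induction j as [|j IH].
      - eapply Rle_trans; [apply Hstep|]. rewrite sum_O. simpl iterate.
        apply Rmult_le_compat_r; [exact Hab|]. specialize (Hom 0%nat). lra.
      - eapply Rle_trans; [apply Hstep|]. rewrite rsum_S.
        pose proof (sum_n_le_series om L j Hom HL) as Hs. pose proof (Hom (S j)) as Ho.
        apply Rle_trans with ((1 + om (S j)) * ((1 + 2 * sum_n om j) * Cmod (a - b))).
        + apply Rmult_le_compat_l; [lra|exact IH].
        + rewrite <- Rmult_assoc. apply Rmult_le_compat_r; [exact Hab|].
          assert (om (S j) * sum_n om j <= om (S j) * (1 / 8)) by (apply Rmult_le_compat_l; lra).
          lra. }
    destruct k as [|k]; [simpl; lra|]. eapply Rle_trans; [apply HS|].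
    apply Rmult_le_compat_r; [exact Hab|].
    pose proof (sum_n_le_series om L k Hom HL). lra. }
  (* Along a single orbit [delta] need not be summable; subtracting its values on the orbit of [w0]
     leaves terms controlled by [om]. The iterates cost a factor [2], so the sum has Lipschitz
     constant [2 * L <= 1 / 4]. *)
  set (t := fun k w => (delta (iterate k F w) - delta (iterate k F w0))%C).
  destruct (lipschitz_series (sector T) t (fun k => 2 * om k) (2 * L) w0)
    as [e [He [Helip Heder]]].
  - exact Hw0.
  - intros k. unfold t. ring.
  - intros k. specialize (Hom k). lra.
  - intros k a b Ha Hb. unfold t.
    replace (delta (iterate k F a) - delta (iterate k F w0)
             - (delta (iterate k F b) - delta (iterate k F w0)))%C
      with (delta (iterate k F a) - delta (iterate k F b))%C by ring.
    eapply Rle_trans; [apply Hlip; apply Hsec; assumption|].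
    specialize (HFk k a b Ha Hb). specialize (Hom k). nra.
  - exact (is_series_scal (K := R_AbsRing) (V := R_NormedModule) 2 om L HL).
  - exists e. repeat split.
    + apply (is_cseries_unique (fun k => t k w0)); [apply He; exact Hw0|].
      apply is_cseries_0. intros k. unfold t. ring.
    + intros a b Ha Hb. eapply Rle_trans; [apply Helip; assumption|].
      apply Rmult_le_compat_r; [apply Cmod_ge_0|lra].
    + intros w Hw. destruct (sector_open T w Hw) as [d [Hd Hdw]].
      apply (Heder w d Hd Hdw).
      assert (Hit : forall k, exists l, cderiv (iterate k F) w l).
      { intros k. induction k as [|k [l Hl]].
        - exists 1. apply cderiv_id.
        - destruct (Hder (iterate k F w) (Hsec0 k w Hw)) as [m Hm].
          eexists. apply (cderiv_comp (iterate k F) F); [exact Hl|].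
          apply cderiv_plus; [|exact Hm]. apply cderiv_plus; [apply cderiv_id|apply cderiv_const]. }
      intros k. destruct (Hit k) as [l Hl].
      destruct (Hder (iterate k F w) (Hsec0 k w Hw)) as [m Hm].
      eexists. unfold t. unfold Cminus. apply cderiv_plus; [|apply cderiv_const].
      apply (cderiv_comp (iterate k F) delta); eassumption.
    + intros w Hw.
      assert (HFw : sector T (F w)) by exact (Hsec0 1%nat w Hw).
      assert (E : (e (F w) - e w)%C = (- delta w)%C).
      { apply (is_cseries_unique (fun k => t k (F w) - t k w)%C).
        - apply is_cseries_minus; apply He; assumption.
        - apply is_cseries_eps. intros eps Heps.
          destruct (Hlim eps Heps) as [M HM].
          (* Chosen so that [N + 1 > 2 * (M - T)]: the partial sum up to [n] ends with the iterate
             [n + 1], whose height then exceeds [M]. *)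
          destruct (nfloor_ex (Rmax 0 (2 * (M - T)))) as [N [_ HN]]; [apply Rmax_l|].
          exists N. intros n Hn.
          (* The base orbit cancels in [t k (F w) - t k w], and what is left telescopes along the
             orbit of [w], where [delta] tends to [0]. *)
          assert (Es : csum (fun k => t k (F w) - t k w)%C n
                       = (delta (iterate (S n) F w) - delta w)%C).
          { assert (Et : forall k, (t k (F w) - t k w)%C
              = (delta (iterate (S k) F w) - delta (iterate k F w))%C).
            { intros k. unfold t. unfold iterate. rewrite <- Nat.iter_succ_r. ring. }
            clear Hn. induction n as [|n IH].
            - rewrite csum_O, Et. reflexivity.
            - rewrite csum_S, IH, Et. refine (_ : @eq C _ _). ring. }
          rewrite Es.
          replace (delta (iterate (S n) F w) - delta w - - delta w)%C
            with (delta (iterate (S n) F w)) by ring.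
          apply HM. pose proof (Hsec (S n) w Hw) as H. unfold sector in *.
          rewrite S_INR in H. apply le_INR in Hn.
          pose proof (Rmax_r 0 (2 * (M - T))). lra. }
      change (w + 1 + delta w)%C with (F w).
      replace (e (F w)) with (e (F w) - e w + e w)%C by ring. rewrite E. ring.
Qed.

(** * Surjectivity by contraction *)

(** Picard iteration from the centre, with increments dominated by a geometric series. The
    hypotheses are confined to the disk because [e] is controlled only on the sector. *)
Lemma contraction_closed_disk (g : C -> C) (z : C) (s : R) :
  (forall w, Cmod (w - z) <= s -> Cmod (g w - z) <= s) ->
  (forall a b, Cmod (a - z) <= s -> Cmod (b - z) <= s ->
     Cmod (g a - g b) <= 1 / 4 * Cmod (a - b)) ->
  0 <= s -> exists w, Cmod (w - z) <= s /\ g w = w.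
Proof.
  intros Hmap Hlip Hs. set (u := fun k => iterate k g z).
  assert (Hu : forall k, Cmod (u k - z) <= s).
  { intros k. induction k as [|k IH]; [|apply Hmap; exact IH].
    unfold u; simpl. replace (z - z)%C with (RtoC 0) by ring. rewrite Cmod_0. exact Hs. }
  assert (Hstep : forall k, Cmod (u (S k) - u k) <= s * (1 / 4) ^ k).
  { intros k. induction k as [|k IH].
    - rewrite Rmult_1_r. exact (Hu 1%nat).
    - change (u (S (S k)) - u (S k))%C with (g (u (S k)) - g (u k))%C.
      eapply Rle_trans; [apply Hlip; apply Hu|]. rewrite <- tech_pow_Rmult. lra. }
  destruct (ex_series_le (K := C_AbsRing) (V := C_CompleteNormedModule)
    (fun k => u (S k) - u k)%C (fun k => s * (1 / 4) ^ k) Hstep) as [l Hl].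
  { apply (ex_series_scal (K := R_AbsRing) (V := R_NormedModule) s).
    exists (/ (1 - 1 / 4)). apply is_series_geom. rewrite Rabs_pos_eq; lra. }
  assert (Hsum : forall n, csum (fun k => u (S k) - u k)%C n = (u (S n) - z)%C).
  { intros n. induction n as [|n IH]; [rewrite csum_O; reflexivity|].
    rewrite csum_S, IH. refine (_ : @eq C _ _). ring. }
  set (w := (z + l)%C).
  assert (Hw : forall eps, 0 < eps -> exists n, Cmod (u n - w) < eps /\ Cmod (u (S n) - w) < eps).
  { intros eps Heps. destruct (proj1 (is_cseries_eps _ l) Hl eps Heps) as [N HN].
    exists (S N). pose proof (HN N (Nat.le_refl N)) as H1. pose proof (HN (S N) (Nat.le_succ_diag_r N)) as H2.
    rewrite Hsum in H1, H2. unfold w. split.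
    - replace (u (S N) - (z + l))%C with (u (S N) - z - l)%C by ring. exact H1.
    - replace (u (S (S N)) - (z + l))%C with (u (S (S N)) - z - l)%C by ring. exact H2. }
  assert (Hwz : Cmod (w - z) <= s).
  { apply Rle_plus_epsilon. intros eps Heps. destruct (Hw eps Heps) as [n [H1 _]].
    pose proof (Cmod_sub_triangle w (u n) z) as T. rewrite (Cmod_sub_sym w (u n)) in T.
    specialize (Hu n). lra. }
  exists w. split; [exact Hwz|].
  assert (E : (g w - w)%C = RtoC 0).
  { apply Cmod_eq_0. apply Rle_antisym; [|apply Cmod_ge_0].
    apply Rle_plus_epsilon. intros eps Heps. destruct (Hw (eps / 2)) as [n [H1 H2]]; [lra|].
    pose proof (Cmod_sub_triangle (g w) (g (u n)) w) as T.
    pose proof (Hlip w (u n) Hwz (Hu n)) as H. rewrite (Cmod_sub_sym w (u n)) in H.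
    change (u (S n)) with (g (u n)) in H2. pose proof (Cmod_ge_0 (u n - w)). lra. }
  replace (g w) with (g w - w + w)%C by ring. rewrite E. ring.
Qed.

Lemma Cmod_le_Re_Im (w : C) : Cmod w <= Rabs (Re w) + Rabs (Im w).
Proof.
  apply Rsqr_incr_0_var; [|pose proof (Rabs_pos (Re w)); pose proof (Rabs_pos (Im w)); lra].
  pose proof (Cmod2_alt w) as E. rewrite <- (pow2_abs (Re w)), <- (pow2_abs (Im w)) in E.
  pose proof (Rabs_pos (Re w)). pose proof (Rabs_pos (Im w)). unfold Rsqr. nra.
Qed.

(** The map [w -> z - e w] contracts the disk of radius [s] about [z]: as [e] vanishes at [x0], its
    modulus there is at most [(s + Cmod (z - x0)) / 4], which equals [s] for the chosen [s]. The
    disk lies in the sector because the height drops by at most [2 s <= 2/3 (Re z - x0 + |Im z|)],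
    which is less than [height z - T]. *)
Lemma sector_perturbation_onto (e : C -> C) (T x0 : R) (z : C) :
  0 < T < x0 -> e x0 = RtoC 0 ->
  (forall a b, sector T a -> sector T b -> Cmod (e a - e b) <= 1 / 4 * Cmod (a - b)) ->
  3 * x0 < Re z -> exists w, sector T w /\ (w + e w)%C = z.
Proof.
  intros HT He0 Hlip Hz.
  assert (Hx0 : sector T x0).
  { unfold sector, height, Re, Im; simpl. rewrite Rabs_R0. lra. }
  set (s := 1 / 3 * Cmod (z - x0)).
  assert (Hs : 0 <= s) by (unfold s; pose proof (Cmod_ge_0 (z - x0)); lra).
  assert (Hsec : forall w, Cmod (w - z) <= s -> sector T w).
  { intros w Hw. pose proof (height_lipschitz w z) as Hh. apply Rabs_le_between in Hh.
    pose proof (Cmod_le_Re_Im (z - x0)) as Hm.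
    assert (E1 : Re (z - x0) = Re z - x0) by reflexivity.
    assert (E2 : Im (z - x0) = Im z) by (unfold Im; simpl; ring).
    rewrite E1, E2, (Rabs_pos_eq (Re z - x0)) in Hm by lra.
    unfold sector, height in *. unfold s in *. pose proof (Rabs_pos (Im z)). lra. }
  destruct (contraction_closed_disk (fun w => z - e w)%C z s) as [w [Hw E]].
  - intros w Hw. replace (z - e w - z)%C with (- (e w - e x0))%C by (rewrite He0; ring).
    rewrite Cmod_opp. eapply Rle_trans; [apply Hlip; auto|].
    pose proof (Cmod_sub_triangle w z x0). unfold s in *. lra.
  - intros a b Ha Hb. replace (z - e a - (z - e b))%C with (- (e a - e b))%C by ring.
    rewrite Cmod_opp. apply Hlip; auto.
  - exact Hs.
  - exists w. split; [apply Hsec; exact Hw|]. rewrite <- E at 1. ring.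
Qed.

(** * Paths, homotopies and simple connectivity *)

Lemma path_continuous_eps (g : R -> C) :
  continuous_on (U := C_UniformSpace) unit_interval g <->
  forall t, unit_interval t -> forall eps, 0 < eps -> exists d, 0 < d /\
    forall u, unit_interval u -> Rabs (u - t) < d -> Cmod (g u - g t) < eps.
Proof.
  split.
  - intros H t Ht eps Heps.
    assert (L : locally (T := C_UniformSpace) (g t) (fun w => Cmod (w - g t) < eps)).
    { apply locally_Cmod. exists eps. split; [exact Heps|]. auto. }
    destruct (H t Ht _ L) as [d Hd]. exists d. split; [apply cond_pos|].
    intros u Hu Hut. exact (Hd u Hut Hu).
  - intros H t Ht P HP. apply locally_Cmod in HP. destruct HP as [eps [Heps HP]].
    destruct (H t Ht eps Heps) as [d [Hd Hg]]. exists (mkposreal d Hd).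
    intros u Hut Hu. apply HP, Hg; assumption.
Qed.

Lemma square_continuous_eps (g : R * R -> C) :
  (forall s t, unit_interval s -> unit_interval t -> forall eps, 0 < eps -> exists d, 0 < d /\
    forall s' t', unit_interval s' -> unit_interval t' -> Rabs (s' - s) < d -> Rabs (t' - t) < d ->
      Cmod (g (s', t') - g (s, t)) < eps) ->
  continuous_on (T := prod_UniformSpace R_UniformSpace R_UniformSpace) (U := C_UniformSpace)
    unit_square g.
Proof.
  intros H [s t] [Hs Ht] P HP. apply locally_Cmod in HP. destruct HP as [eps [Heps HP]].
  destruct (H s t Hs Ht eps Heps) as [d [Hd Hg]]. exists (mkposreal d Hd).
  intros [s' t'] [H1 H2] [Hs' Ht']. apply HP, Hg; assumption.
Qed.

Definition segment (a b : C) (t : R) : C := (a + t * (b - a))%C.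

Lemma segment_half_plane (tau : R) (a b : C) (t : R) :
  right_half_plane tau a -> right_half_plane tau b -> unit_interval t ->
  right_half_plane tau (segment a b t).
Proof.
  unfold right_half_plane, unit_interval. intros Ha Hb Ht.
  replace (Re (segment a b t)) with (Re a + t * (Re b - Re a))
    by (unfold segment, Re; simpl; ring).
  destruct (Rle_lt_dec t (1 / 2)).
  - assert (0 <= t * (Re b - tau)) by (apply Rmult_le_pos; lra).
    assert (0 < (1 - t) * (Re a - tau)) by (apply Rmult_lt_0_compat; lra). lra.
  - assert (0 < t * (Re b - tau)) by (apply Rmult_lt_0_compat; lra).
    assert (0 <= (1 - t) * (Re a - tau)) by (apply Rmult_le_pos; lra). lra.
Qed.

Lemma Cmod_segment_sub (a b a' : C) (t t' : R) : unit_interval t' ->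
  Cmod (segment a' b t' - segment a b t) <= Cmod (a' - a) + Rabs (t' - t) * Cmod (b - a).
Proof.
  intros Ht. unfold segment.
  replace (a' + t' * (b - a') - (a + t * (b - a)))%C
    with (RtoC (1 - t') * (a' - a) + RtoC (t' - t) * (b - a))%C
    by (rewrite !RtoC_minus; ring).
  eapply Rle_trans; [apply Cmod_triangle|]. rewrite !Cmod_mult, !Cmod_R.
  apply Rplus_le_compat_r. rewrite <- (Rmult_1_l (Cmod (a' - a))) at 2.
  apply Rmult_le_compat_r; [apply Cmod_ge_0|]. unfold unit_interval in Ht. apply Rabs_le. lra.
Qed.

(** A half-plane is convex: points and loops moved there by [Phi] are joined or contracted along
    segments and carried back by [Psi], with continuity from the Lipschitz bounds. *)
Lemma bilipschitz_half_plane_simply_connected (tau K : R) (U : C -> Prop) (Psi Phi : C -> C) :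
  0 < K ->
  (forall z, right_half_plane tau z -> U (Psi z)) ->
  (forall w, U w -> right_half_plane tau (Phi w) /\ Psi (Phi w) = w) ->
  (forall z z', right_half_plane tau z -> right_half_plane tau z' ->
     Cmod (Psi z - Psi z') <= K * Cmod (z - z')) ->
  (forall w w', U w -> U w' -> Cmod (Phi w - Phi w') <= K * Cmod (w - w')) ->
  simply_connected U.
Proof.
  intros HK HU HPhi HlipPsi HlipPhi. split.
  - intros x y Hx Hy. destruct (HPhi x Hx) as [Px Ex]. destruct (HPhi y Hy) as [Py Ey].
    exists (fun t => Psi (segment (Phi x) (Phi y) t)). split; [split|split].
    + apply path_continuous_eps. intros t Ht eps Heps.
      pose proof (Cmod_ge_0 (Phi y - Phi x)) as HM. set (M := Cmod (Phi y - Phi x)) in *.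
      assert (HM1 : 0 < K * (M + 1)) by (apply Rmult_lt_0_compat; lra).
      exists (eps / (K * (M + 1))). split; [apply Rdiv_lt_0_compat; assumption|].
      intros u Hu Hut.
      eapply Rle_lt_trans; [apply HlipPsi; apply segment_half_plane; assumption|].
      pose proof (Cmod_segment_sub (Phi x) (Phi y) (Phi x) t u Hu) as Hseg. fold M in Hseg.
      replace (Phi x - Phi x)%C with (RtoC 0) in Hseg by ring. rewrite Cmod_0 in Hseg.
      apply Rle_lt_trans with (K * (M + 1) * Rabs (u - t)).
      * rewrite Rmult_assoc. apply Rmult_le_compat_l; [lra|]. pose proof (Rabs_pos (u - t)). lra.
      * replace eps with (K * (M + 1) * (eps / (K * (M + 1)))) by (field; lra).
        apply Rmult_lt_compat_l; assumption.
    + intros t Ht. apply HU, segment_half_plane; assumption.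
    + rewrite <- Ex at 2. f_equal. unfold segment. ring.
    + rewrite <- Ey at 2. f_equal. unfold segment. ring.
  - intros g [Hg HgU] Hloop. rewrite path_continuous_eps in Hg.
    assert (H0 : unit_interval 0) by (unfold unit_interval; lra).
    destruct (HPhi (g 0) (HgU 0 H0)) as [Pb Eb]. set (b := Phi (g 0)) in *.
    (* At [t = 0] and at [t = 1] the segment degenerates to the point [b], since the loop is closed;
       so the base point stays fixed. *)
    exists (fun u => Psi (segment (Phi (g (snd u))) b (fst u))). split; [|split; [|split]].
    + apply square_continuous_eps. intros s t Hs Ht eps Heps. simpl.
      pose proof (Cmod_ge_0 (b - Phi (g t))) as HM. set (M := Cmod (b - Phi (g t))) in *.
      destruct (Hg t Ht (eps / (2 * (K * K)))) as [d [Hd Hgt]].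
      { apply Rdiv_lt_0_compat; [lra|]. assert (0 < K * K) by (apply Rmult_lt_0_compat; lra). lra. }
      assert (HM1 : 0 < K * (M + 1)) by (apply Rmult_lt_0_compat; lra).
      exists (Rmin d (eps / (2 * (K * (M + 1))))).
      split; [apply Rmin_pos; [exact Hd|apply Rdiv_lt_0_compat; lra]|].
      intros s' t' Hs' Ht' Hss Htt.
      destruct (HPhi (g t) (HgU t Ht)) as [Pt _]. destruct (HPhi (g t') (HgU t' Ht')) as [Pt' _].
      specialize (Hgt t' Ht' (Rlt_le_trans _ _ _ Htt (Rmin_l _ _))).
      apply (fun H => Rlt_le_trans _ _ _ H (Rmin_r _ _)) in Hss.
      eapply Rle_lt_trans; [apply HlipPsi; apply segment_half_plane; assumption|].
      pose proof (Cmod_segment_sub (Phi (g t)) b (Phi (g t')) s s' Hs') as Hseg. fold M in Hseg.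
      pose proof (HlipPhi (g t') (g t) (HgU t' Ht') (HgU t Ht)) as Hl.
      assert (A : K * (K * Cmod (g t' - g t)) < eps / 2).
      { rewrite <- Rmult_assoc. replace (eps / 2) with (K * K * (eps / (2 * (K * K)))) by (field; lra).
        apply Rmult_lt_compat_l; [apply Rmult_lt_0_compat; lra|exact Hgt]. }
      assert (B : K * (Rabs (s' - s) * M) <= eps / 2).
      { apply Rle_trans with (K * (M + 1) * Rabs (s' - s)).
        - rewrite Rmult_assoc. apply Rmult_le_compat_l; [lra|]. pose proof (Rabs_pos (s' - s)). lra.
        - replace (eps / 2) with (K * (M + 1) * (eps / (2 * (K * (M + 1))))) by (field; lra).
          apply Rmult_le_compat_l; lra. }
      apply Rle_lt_trans with (K * (K * Cmod (g t' - g t) + Rabs (s' - s) * M)); [|lra].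
      apply Rmult_le_compat_l; lra.
    + intros [s t] [Hs Ht]. simpl in *. apply HU, segment_half_plane; try assumption.
      apply HPhi, HgU, Ht.
    + intros t Ht. simpl. destruct (HPhi (g t) (HgU t Ht)) as [_ Et]. split.
      * rewrite <- Et at 2. f_equal. unfold segment. ring.
      * rewrite <- Eb. f_equal. unfold segment. ring.
    + intros s Hs. simpl. rewrite <- Hloop. fold b. split;
        (rewrite <- Eb; f_equal; unfold segment; ring).
Qed.

(** * The linearizing map and its domain *)

Lemma sector_conjugacy (delta e : C -> C) (T x0 tau : R) :
  0 < T < x0 -> e x0 = RtoC 0 ->
  (forall w, sector T w -> sector T (w + 1 + delta w)) ->
  (forall a b, sector T a -> sector T b -> Cmod (e a - e b) <= 1 / 4 * Cmod (a - b)) ->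
  (forall w, sector T w -> exists l, cderiv e w l) ->
  (forall w, sector T w -> (e (w + 1 + delta w) = e w - delta w)%C) ->
  exists (Omega : C -> Prop) (Psi : C -> C),
    simply_connected_domain Omega /\
    (forall w, Omega w -> sector T w) /\
    conformal_onto (right_half_plane tau) Omega Psi /\
    (forall z, right_half_plane tau z ->
       (Psi z + 1 + delta (Psi z))%C = Psi (z + 1)%C).
Proof.
  intros HT He0 Hinv Hlip Hder Habel.
  (* Moves the half-plane [Re > 3 * x0], over which [sector_perturbation_onto] finds preimages, to
     [Re > tau]. *)
  set (N := 3 * x0 - tau).
  set (Phi := fun w => (w + e w - N)%C).
  set (Psi := fun z => epsilon (inhabits (RtoC 0)) (fun w => sector T w /\ Phi w = z)).
  set (Omega := fun w => sector T w /\ right_half_plane tau (Phi w)).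
  assert (HPsi : forall z, right_half_plane tau z -> sector T (Psi z) /\ Phi (Psi z) = z).
  { intros z Hz. unfold Psi. apply epsilon_spec. unfold right_half_plane in Hz.
    destruct (sector_perturbation_onto e T x0 (z + N) HT He0 Hlip) as [w [Hw E]].
    - replace (Re (z + N)) with (Re z + N) by reflexivity. unfold N. lra.
    - exists w. split; [exact Hw|]. unfold Phi. rewrite E. ring. }
  (* A [1/4]-Lipschitz perturbation shrinks distances at most by the factor [3/4]; the resulting
     [4/3] is rounded up to [2]. This gives both injectivity of [Phi] on the whole sector and the
     Lipschitz bound for [Psi]. *)
  assert (Hexp : forall a b, sector T a -> sector T b -> Cmod (a - b) <= 2 * Cmod (Phi a - Phi b)).
  { intros a b Ha Hb. specialize (Hlip a b Ha Hb).
    pose proof (Cmod_triangle (Phi a - Phi b) (- (e a - e b))) as T'.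
    replace (Phi a - Phi b + - (e a - e b))%C with (a - b)%C in T' by (unfold Phi; ring).
    rewrite Cmod_opp in T'. pose proof (Cmod_ge_0 (a - b)). lra. }
  assert (Hcontr : forall a b, sector T a -> sector T b -> Cmod (Phi a - Phi b) <= 2 * Cmod (a - b)).
  { intros a b Ha Hb. specialize (Hlip a b Ha Hb).
    replace (Phi a - Phi b)%C with ((a - b) + (e a - e b))%C by (unfold Phi; ring).
    eapply Rle_trans; [apply Cmod_triangle|]. pose proof (Cmod_ge_0 (a - b)). lra. }
  assert (HPhi : forall w, Omega w -> Psi (Phi w) = w).
  { intros w [Hw Hh]. destruct (HPsi _ Hh) as [Hs E].
    assert (E0 : (Psi (Phi w) - w)%C = RtoC 0).
    { apply Cmod_eq_0. apply Rle_antisym; [|apply Cmod_ge_0].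
      eapply Rle_trans; [apply Hexp; assumption|]. rewrite E.
      replace (Phi w - Phi w)%C with (RtoC 0) by ring. rewrite Cmod_0. lra. }
    replace (Psi (Phi w)) with (Psi (Phi w) - w + w)%C by ring. rewrite E0. ring. }
  assert (HOmega : forall z, right_half_plane tau z -> Omega (Psi z)).
  { intros z Hz. destruct (HPsi z Hz) as [Hs E]. split; [exact Hs|]. rewrite E. exact Hz. }
  assert (HlipPsi : forall z z', right_half_plane tau z -> right_half_plane tau z' ->
    Cmod (Psi z - Psi z') <= 2 * Cmod (z - z')).
  { intros z z' Hz Hz'. destruct (HPsi z Hz) as [Hs E]. destruct (HPsi z' Hz') as [Hs' E'].
    rewrite <- E at 2. rewrite <- E' at 2. apply Hexp; assumption. }
  exists Omega, Psi. split; [|split; [|split; [split; [split|split]|]]].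
  - split; [|split].
    + exists (Psi (tau + 1)%C). apply HOmega. unfold right_half_plane, Re; simpl. lra.
    + intros w [Hw Hh]. apply locally_Cmod. destruct (sector_open T w Hw) as [d [Hd Hdw]].
      unfold right_half_plane in Hh. set (gap := Re (Phi w) - tau).
      exists (Rmin d (gap / 2)). unfold gap. split; [apply Rmin_pos; lra|]. intros z Hz.
      assert (Hsz : sector T z) by (apply Hdw; eapply Rlt_le_trans; [exact Hz|apply Rmin_l]).
      split; [exact Hsz|]. unfold right_half_plane.
      pose proof (Rlt_le_trans _ _ _ Hz (Rmin_r _ _)) as Hz2.
      pose proof (Hcontr z w Hsz Hw) as Hc. pose proof (re_le_Cmod (Phi z - Phi w)) as Hr.
      apply Rabs_le_between in Hr.
      replace (Re (Phi z - Phi w)) with (Re (Phi z) - Re (Phi w)) in Hr by reflexivity. lra.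
    + apply (bilipschitz_half_plane_simply_connected tau 2 Omega Psi Phi); [lra|exact HOmega| |exact HlipPsi|].
      * intros w Hw. split; [apply Hw|apply HPhi; exact Hw].
      * intros w w' Hw Hw'. apply Hcontr; [apply Hw|apply Hw'].
  - intros w Hw. apply Hw.
  - intros z Hz. destruct (HPsi z Hz) as [Hs E]. destruct (Hder _ Hs) as [l Hl].
    assert (HPder : cderiv Phi (Psi z) (1 + l + 0)).
    { unfold Phi, Cminus. apply cderiv_plus; [|apply cderiv_const].
      apply cderiv_plus; [apply cderiv_id|exact Hl]. }
    destruct (sector_open T _ Hs) as [d [Hd Hdw]].
    assert (Hl4 : Cmod l <= 1 / 4).
    { apply (cderiv_lipschitz_le e (Psi z) l d); [exact Hd| |exact Hl].
      intros w Hw. apply Hlip; auto. }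
    eexists. apply cderiv_is_derive.
    apply (cderiv_inverse Psi Phi z (1 + l + 0)%C 2 (Re z - tau)); [|exact HPder| |].
    (* A vanishing derivative of [Phi] would force [l = -1], against [Cmod l <= 1 / 4]. *)
    + intros E0. replace l with (- (1))%C in Hl4; [rewrite Cmod_opp, Cmod_1 in Hl4; lra|].
      replace l with (1 + l + 0 - 1)%C by ring. rewrite E0. ring.
    + unfold right_half_plane in Hz. lra.
    + intros w Hw. assert (Hwh : right_half_plane tau w).
      { unfold right_half_plane. pose proof (re_le_Cmod (w - z)) as Hr.
        apply Rabs_le_between in Hr.
        replace (Re (w - z)) with (Re w - Re z) in Hr by reflexivity. lra. }
      split; [apply HPsi; exact Hwh|]. apply HlipPsi; assumption.
  - intros z1 z2 H1 H2 E. destruct (HPsi z1 H1) as [_ E1]. destruct (HPsi z2 H2) as [_ E2].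
    rewrite <- E1, <- E2, E. reflexivity.
  - exact HOmega.
  - intros w Hw. exists (Phi w). split; [apply Hw|apply HPhi; exact Hw].
  - intros z Hz. destruct (HPsi z Hz) as [Hs E].
    (* The Abel equation: one step of the dynamics advances [Phi] by [1]. The new point therefore
       stays in [Omega], where [Psi] inverts [Phi]. *)
    assert (E1 : Phi (Psi z + 1 + delta (Psi z))%C = (z + 1)%C).
    { rewrite <- E at 3. unfold Phi. rewrite Habel by exact Hs. ring. }
    rewrite <- E1. symmetry. apply HPhi. split; [apply Hinv; exact Hs|].
    rewrite E1. unfold right_half_plane, Re in *. simpl. lra.
Qed.

Theorem theorem13
  (f : C -> C) (r0 : R) (p : Z) (q : nat)
  (Hf : parabolic_germ f r0 p q)
  (n : nat) (a : C)
  (Hfq : iterate_expansion f r0 q n a)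
  (P : C -> Prop)
  (HP : attracting_petal f r0 q P)
  (tau0 : R) (phi_inv : C -> C)
  (Hphi : petal_coordinate_inverse n a tau0 P phi_inv)
  (b : nat -> C) (eta : C -> C) (r : R)
  (Hr : 0 < r)
  (Heta : perturbation_series b r eta)
  (HF : forall w : C, right_half_plane tau0 w ->
     petal_coordinate n a (iterate q f (phi_inv w)) = fatou_map n eta w)
  (Heta_small : forall xi : C, Cmod xi <= r -> Cmod (eta xi) <= 1 / 2)
  (tau : R)
  (Htau : 1 / r ^ n + 1 < tau) :
  exists (Omega : C -> Prop) (Psi : C -> C),
    simply_connected_domain Omega /\
    (forall w : C, Omega w -> fatou_map_domain n r w) /\
    conformal_onto (right_half_plane tau) Omega Psi /\
    (forall w : C, right_half_plane tau w ->
       fatou_map n eta (Psi w) = Psi (w + 1)%C).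
Proof.
  pose proof (expansion_n_pos _ _ _ _ _ Hfq) as n_pos.
  destruct (perturbation_series_regular b r eta Hr Heta) as [Heta0 [K [HK [HKlip HKder]]]].
  destruct (inv_nroot_lipschitz n n_pos) as [K' [HK' HK'lip]].
  destruct (INR_inv_bounds n n_pos) as [Hal Hal1]. set (al := / INR n) in *.
  assert (HKK : 0 < K * K') by (apply Rmult_lt_0_compat; assumption).
  (* [r / 8] puts the argument of [eta] inside the disk of radius [r / 4], where [eta] is
     [K]-Lipschitz; since [eta 0 = 0], the bound [1 / 4 / K] then gives
     [Cmod (delta w) <= 1 / 4]. *)
  set (eps0 := Rmin (r / 8) (1 / 4 / K)).
  assert (Heps0 : 0 < eps0) by (apply Rmin_pos; repeat apply Rdiv_lt_0_compat; lra).
  destruct (Rpower_tends_0 al eps0 Hal Heps0) as [M0 [HM0 HM0']].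
  (* This value, inserted in the bound of [Rpower_series], makes [K * K' * L] at most [1 / 8]. *)
  destruct (Rpower_tends_0 al (1 / 8 * (al / 4) / (K * K')) Hal) as [M1 [HM1 HM1']].
  { apply Rdiv_lt_0_compat; lra. }
  (* In [sector T] the modulus exceeds [T / 2 = M0 + M1 + 1], hence [M0]; and
     [T / 2 - 1 / 4 >= M1]. *)
  set (T := 2 * (M0 + M1 + 1)).
  set (delta := fun w => eta (/ nroot n w)%C).
  assert (Hmod : forall m w, sector m w -> m / 2 < Cmod w).
  { intros m w Hw. unfold sector in Hw. pose proof (height_le_Cmod w). lra. }
  assert (Hroot : forall w, sector T w -> Cmod (/ nroot n w) <= eps0).
  { intros w Hw. rewrite Cmod_inv_nroot. apply HM0'. apply Hmod in Hw. unfold T in Hw. lra. }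
  assert (Hdisk : forall w, sector T w -> disk (r / 4) (/ nroot n w)%C).
  { intros w Hw. unfold disk. specialize (Hroot w Hw).
    pose proof (Rmin_l (r / 8) (1 / 4 / K)) as Hm. fold eps0 in Hm. lra. }
  assert (Hdelta : forall w, sector T w -> Cmod (delta w) <= K * Cmod (/ nroot n w)).
  { intros w Hw. assert (H0 : disk (r / 4) 0) by (unfold disk; rewrite Cmod_0; lra).
    pose proof (HKlip _ 0 (Hdisk w Hw) H0) as H. rewrite Heta0 in H. unfold delta.
    replace (eta (/ nroot n w) - 0)%C with (eta (/ nroot n w)%C) in H by ring.
    replace (/ nroot n w - 0)%C with (/ nroot n w)%C in H by ring. exact H. }
  assert (Hd4 : forall w, sector T w -> Cmod (delta w) <= 1 / 4).
  { intros w Hw. eapply Rle_trans; [apply Hdelta; exact Hw|].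
    replace (1 / 4) with (K * (1 / 4 / K)) by (field; lra).
    apply Rmult_le_compat_l; [lra|]. eapply Rle_trans; [apply Hroot; exact Hw|apply Rmin_r]. }
  destruct (Rpower_series al (T / 2) Hal ltac:(unfold T; lra)) as [L [HL HLle]].
  assert (HT0 : 0 < T) by (unfold T; lra).
  assert (Hx0 : sector T (RtoC (T + 1))).
  { unfold sector, height, Re, Im; simpl. rewrite Rabs_R0. lra. }
  (* On [sector (T + INR k / 2)] the modulus exceeds [T / 2 + INR k / 4], which serves as [mu] in
     the Lipschitz bound for the inverse root; hence this choice of [om]. *)
  destruct (fatou_coordinate delta T (K * K' * L)
    (fun k => K * K' * Rpower (T / 2 + INR k / 4) (- (1 + al))) (RtoC (T + 1)))
    as [e [He0 [Helip [Heder Habel]]]].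
  - exact Hd4.
  - intros k. apply Rmult_le_pos; [lra|apply Rlt_le, exp_pos].
  - intros k x y Hx Hy. pose proof (pos_INR k) as Hk.
    assert (Hx' : sector T x) by (unfold sector in *; lra).
    assert (Hy' : sector T y) by (unfold sector in *; lra).
    eapply Rle_trans; [apply HKlip; apply Hdisk; assumption|].
    rewrite !Rmult_assoc. apply Rmult_le_compat_l; [lra|]. rewrite <- Rmult_assoc.
    apply Hmod in Hx, Hy. apply HK'lip; unfold sector in *; lra.
  - exact (is_series_scal (K := R_AbsRing) (V := R_NormedModule) (K * K') _ L HL).
  - apply Rle_trans with (K * K' * (4 / al * (1 / 8 * (al / 4) / (K * K')))).
    + apply Rmult_le_compat_l; [lra|]. eapply Rle_trans; [exact HLle|].
      apply Rmult_le_compat_l; [apply Rlt_le, Rdiv_lt_0_compat; lra|].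
      apply HM1'. unfold T. lra.
    + right. field. lra.
  - intros w Hw. destruct (inv_nroot_cderiv n w n_pos) as [l Hl]; [unfold sector in *; lra|].
    destruct (HKder _ (Hdisk w Hw)) as [m Hm]. eexists.
    apply (cderiv_comp (fun w => / nroot n w)%C eta); eassumption.
  - intros eps Heps. destruct (Rpower_tends_0 al (eps / 2 / K) Hal) as [M [HM HM']].
    { repeat apply Rdiv_lt_0_compat; lra. }
    exists (T + 2 * M). intros w Hw. pose proof (Hmod _ w Hw) as Hm.
    eapply Rle_lt_trans; [apply Hdelta; unfold sector in *; lra|].
    rewrite Cmod_inv_nroot. apply Rle_lt_trans with (K * (eps / 2 / K)).
    + apply Rmult_le_compat_l; [lra|]. apply HM'. lra.
    + replace (K * (eps / 2 / K)) with (eps / 2) by (field; lra). lra.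
  - exact Hx0.
  - destruct (sector_conjugacy delta e T (T + 1) tau) as [Omega [Psi [H1 [H2 [H3 H4]]]]]; try assumption.
    + lra.
    + intros w Hw. pose proof (sector_translate T w (delta w) Hw (Hd4 w Hw)).
      unfold sector in *. lra.
    + exists Omega, Psi. split; [exact H1|]. split; [|split; [exact H3|exact H4]].
      intros w Hw. apply H2 in Hw. split.
      * unfold slit_plane. unfold sector, height in Hw.
        destruct (Rlt_or_le 0 (Re w)) as [H|H]; [left; exact H|right].
        intros E. rewrite E, Rabs_R0 in Hw. lra.
      * pose proof (Hdisk w Hw) as H. unfold disk in H. lra.
Qed.
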